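(* Let $e\geq 2$ be an integer. Assume that the following statement (C) is true. (C) For every integer $d\geq 1$, every $m\geq 0$, every $X\in\mathcal{P}^m$ and every odd $k\in\mathbb{N}$, if $$(X_1,X_2)=\Psi_{(d,(m,m+kd))}\circ\cdots\circ\Psi_{(d,(m,m+d))}\circ\Psi_{(d,(m,m))}(X,X)\in\mathcal{P}^m\times\mathcal{P}^{m+(k+1)d},$$ then $X_1\subset X_2$. Let $\lambda$ be an $e$-regular partition and set $(\mu^1,\mu^2):=\widetilde{\psi}_{(e,(0,0))}(\lambda,\lambda)$. Then $$\widetilde{\psi}_{(e,(0,0))}(m_e(\lambda),m_e(\lambda))=\widetilde{\psi}_{(2e,(0,e))}(m_e(\lambda),m_e(\lambda))=(m_{2e}(\mu^1),m_{2e}(\mu^2))=(m_e(\mu^1),m_e(\mu^2)).$$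
   Context: **Partitions.** A partition is a non-increasing sequence of nonnegative integers (trailing zeros are ignored); its rank is the sum of its parts; $\emptyset$ is the empty partition. For an integer $d\ge 2$, a partition is $d$-regular if no nonzero part is repeated $d$ or more times. The Young diagram of $\lambda$ is $\{(a,b): a\ge1,\ 1\le b\le\lambda_a\}$. A bipartition of $n$ is a pair $\boldsymbol{\lambda}=(\lambda^1,\lambda^2)$ of partitions with $|\lambda^1|+|\lambda^2|=n$ ($n$ is its rank). Its Young diagram is $\{(a,b,c): a\ge 1,\ c\in\{1,2\},\ 1\le b\le\lambda^c_a\}$. A node of a (bi)partition is removable if deleting it from the diagram gives the diagram of a (bi)partition; a node not in the diagram is addable if adding it gives the diagram of a (bi)partition. **Level 1 Kashiwara operators and the Mullineux involution.** Let $d\ge2$. The residue of a node $(a,b)$ is $b-a+d\mathbb{Z}$. For $i\in\mathbb{Z}$, list all addable and removable nodes of $\lambda$ of residue $i+d\mathbb{Z}$ in increasing order, where $(a,b)>(a',b')$ if $a<a'$; encode addable nodes by $A$, removable nodes by $R$, and delete factors $RA$ recursively as long as possible, obtaining a word $A^pR^q$. If $p>0$, $\widetilde{f}_{i+d\mathbb{Z},d}\lambda$ is obtained from $\lambda$ by adding the node of the rightmost remaining $A$; if $p=0$, $\widetilde{f}_{i+d\mathbb{Z},d}\lambda=0$. The $d$-regular partitions are exactly the partitions of the form $\widetilde{f}_{i_1+d\mathbb{Z},d}\cdots\widetilde{f}_{i_n+d\mathbb{Z},d}\emptyset$. The Mullineux involution $m_d$ on $d$-regular partitions is given by: if $\lambda=\widetilde{f}_{i_1+d\mathbb{Z},d}\cdots\widetilde{f}_{i_n+d\mathbb{Z},d}\emptyset$,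 then $m_d(\lambda)=\widetilde{f}_{-i_1+d\mathbb{Z},d}\cdots\widetilde{f}_{-i_n+d\mathbb{Z},d}\emptyset$ (this is well defined, nonzero and $d$-regular; by Kleshchev's theorem it agrees with the Mullineux involution labelling twisted simple modules of the Hecke algebra of the symmetric group at a primitive $d$-th root of unity). **Level 2 Kashiwara operators.** Fix an integer $d\ge 2$ and a bicharge $\mathbf{s}=(s_1,s_2)\in\mathbb{Z}^2$. The content of a node $\gamma=(a,b,c)$ is $b-a+s_c$, and its residue is its content modulo $d$. For $i\in\mathbb{Z}$, an $i$-node is a node of residue $i+d\mathbb{Z}$. For two addable or removable $i$-nodes $\gamma=(a,b,c)$, $\gamma'=(a',b',c')$ of $\boldsymbol\lambda$, write $\gamma\prec_{\mathbf{s}}\gamma'$ if $b-a+s_c<b'-a'+s_{c'}$, or if $b-a+s_c=b'-a'+s_{c'}$ and $c>c'$. Write all addable and removable $i$-nodes of $\boldsymbol{\lambda}$ in increasing order for $\prec_{\mathbf s}$, encoding addable nodes by $A$ and removable nodes by $R$, and delete factors $RA$ recursively as long as possible, to obtain a word $A^pR^q$. If $p>0$, the node of the rightmost remaining $A$ is the good addable $i$-node; if $q>0$, the node of the leftmost remaining $R$ is the good removable $i$-node. Then $\widetilde{f}^{\mathbf{s}}_{i+d\mathbb{Z},d}\boldsymbol\lambda$ is obtained by adding the good addable $i$-node (it is $0$ if there is none), and $\widetilde{e}^{\mathbf{s}}_{i+d\mathbb{Z},d}\boldsymbol\lambda$ by removing the good removable $i$-node (it is $0$ if there is none). **Uglov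 bipartitions.** $\Phi_{(d,\mathbf{s})}$ is the set of bipartitions of the form $\widetilde{f}^{\mathbf s}_{i_1+d\mathbb{Z},d}\cdots\widetilde{f}^{\mathbf s}_{i_n+d\mathbb{Z},d}(\emptyset,\emptyset)$ with $n\ge 0$, $(i_1,\dots,i_n)\in\mathbb{Z}^n$; $\Phi_{(d,\mathbf{s})}(n)$ is its subset of bipartitions of rank $n$. For $\lambda$ $e$-regular one has $(\lambda,\lambda)\in\Phi_{(e,(0,0))}\cap\Phi_{(2e,(0,e))}$. **Crystal isomorphisms.** $\psi_{(d,(s_1,s_2))}:\Phi_{(d,(s_1,s_2))}\to\Phi_{(d,(s_1,s_2+d))}$ is the unique bijection (known to exist) that preserves rank and commutes with the Kashiwara operators: $\psi(\widetilde{f}^{(s_1,s_2)}_{i+d\mathbb{Z},d}\boldsymbol\lambda)=\widetilde{f}^{(s_1,s_2+d)}_{i+d\mathbb{Z},d}\psi(\boldsymbol\lambda)$ and similarly for $\widetilde{e}$, with the convention $\psi(0)=0$. **The map $\widetilde\psi$.** Let $s_1\le s_2$. For each $n$, the restriction of $\psi_{(d,(s_1,t))}$ to $\Phi_{(d,(s_1,t))}(n)$ is the identity as soon as $t-s_1>n-1$. For $\boldsymbol\lambda\in\Phi_{(d,(s_1,s_2))}(n)$ one sets $$\widetilde{\psi}_{(d,(s_1,s_2))}(\boldsymbol\lambda)=\psi_{(d,(s_1,s_2+(k-1)d))}\circ\cdots\circ\psi_{(d,(s_1,s_2+d))}\circ\psi_{(d,(s_1,s_2))}(\boldsymbol\lambda)$$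 for $k$ sufficiently large (the result does not depend on the large $k$ chosen). Both components of a bipartition in the image of $\widetilde\psi_{(d,(s_1,s_2))}$ are $d$-regular. **The combinatorial maps $\Psi$.** For $r\ge 0$, $\mathcal{P}^r$ is the set of strictly increasing sequences of $r$ nonnegative integers, identified with $r$-element subsets of $\mathbb{Z}_{\ge 0}$. Let $d\ge 1$ and $0\le m_1\le m_2$. For $X_1=\{a_1<\cdots<a_{m_1}\}\in\mathcal{P}^{m_1}$ and $X_2\in\mathcal{P}^{m_2}$, define an injection $\varphi:X_1\to X_2$ by treating $a_1,a_2,\dots,a_{m_1}$ successively: $\varphi(a_j)$ is the largest element $b$ of $X_2\setminus\{\varphi(a_1),\dots,\varphi(a_{j-1})\}$ with $b\le a_j$ if such an element exists, and otherwise is the largest element of $X_2\setminus\{\varphi(a_1),\dots,\varphi(a_{j-1})\}$. Then $\Psi_{(d,(m_1,m_2))}:\mathcal{P}^{m_1}\times\mathcal{P}^{m_2}\to\mathcal{P}^{m_1}\times\mathcal{P}^{m_2+d}$ sends $(X_1,X_2)$ to $(Y_1,Y_2)$ with $$Y_1=\varphi(X_1),\qquad Y_2=\{a+d: a\in X_1\}\cup\{b+d: b\in X_2\setminus Y_1\}\cup\{0,1,\dots,d-1\}.$$ *)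

(* Defs.v *)
From HB Require Import structures.
From mathcomp Require Import all_boot all_order all_algebra.
From mathcomp Require Import boolp classical_sets functions.

Set Implicit Arguments.
Unset Strict Implicit.
Unset Printing Implicit Defensive.

Import Order.TTheory GRing.Theory Num.Theory.

(** * Partitions *)

(* The canonical representative is used: trailing zeros are dropped. *)
Definition is_partition (la : seq nat) : bool := sorted geq la && (0 \notin la).

Definition regular (d : nat) (la : seq nat) : bool :=
  is_partition la && all (fun p => count_mem p la < d) la.

(* A node is a pair (row, column), both counted from 0; its content
   column - row is the same as with coordinates counted from 1. *)
Definition node := (nat * nat)%type.

(* The node (a, b) lies in the diagram iff b < nth 0 la a.  A list of row
   lengths is a diagram iff it is non-increasing; zero rows are harmless. *)
Definition addable (la : seq nat) (x : node) : bool :=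
  (x.2 == nth 0 la x.1) && sorted geq (incr_nth la x.1).

Definition removable (la : seq nat) (x : node) : bool :=
  (x.2.+1 == nth 0 la x.1) && sorted geq (set_nth 0 la x.1 x.2).

Definition add_node (la : seq nat) (x : node) : seq nat := incr_nth la x.1.

Definition remove_node (la : seq nat) (x : node) : seq nat :=
  [seq p <- set_nth 0 la x.1 x.2 | p != 0].

Definition addable_nodes (la : seq nat) : seq node :=
  [seq x <- [seq (a, nth 0 la a) | a <- iota 0 (size la).+1] | addable la x].

Definition removable_nodes (la : seq nat) : seq node :=
  [seq x <- [seq (a, (nth 0 la a).-1) | a <- iota 0 (size la)]
     | removable la x].

(** * Signatures *)

Section Signature.
Variable T : Type.

(* A letter is (true, x) for an addable node x (letter A) and (false, x) for a
   removable node x (letter R). *)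
Definition letters (adds rems : seq T) : seq (bool * T) :=
  [seq (true, x) | x <- adds] ++ [seq (false, x) | x <- rems].

(* Deletes factors RA until the word has the form A^p R^q. *)
Fixpoint reduce_word (w : seq (bool * T)) : seq (bool * T) :=
  if w is x :: w' then
    if (x.1, reduce_word w') is (false, (true, _) :: r) then r
    else x :: reduce_word w'
  else [::].

(* Rightmost remaining A. *)
Definition good_addable (w : seq (bool * T)) : option T :=
  ohead (rev [seq x.2 | x <- reduce_word w & x.1]).

(* Leftmost remaining R. *)
Definition good_removable (w : seq (bool * T)) : option T :=
  ohead [seq x.2 | x <- reduce_word w & ~~ x.1].

End Signature.

(** * Level 1 *)

Definition has_residue1 (d : nat) (i : int) (x : node) : bool :=
  (x.2%:Z - x.1%:Z == i %[mod d])%Z.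

(* Increasing order of nodes means decreasing rows. *)
Definition signature1 (d : nat) (i : int) (la : seq nat) : seq (bool * node) :=
  sort (fun u v => v.2.1 <= u.2.1)
    [seq u <- letters (addable_nodes la) (removable_nodes la)
       | has_residue1 d i u.2].

(* [None] plays the role of 0. *)
Definition ftilde1 (d : nat) (i : int) (la : seq nat) : option (seq nat) :=
  omap (add_node la) (good_addable (signature1 d i la)).

(* f_(i_1) ... f_(i_n) applied to the empty partition. *)
Definition fword1 (d : nat) (w : seq int) : option (seq nat) :=
  foldr (fun i => obind (ftilde1 d i)) (Some [::]) w.

(* [m] is the Mullineux involution on d-regular partitions, which are exactly
   the values of [fword1 d]; the values of [m] elsewhere are irrelevant. *)
Definition is_mullineux (d : nat) (m : seq nat -> seq nat) : Prop :=
  forall (w : seq int) (la : seq nat),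
    fword1 d w = Some la -> fword1 d [seq (- i)%R | i <- w] = Some (m la).

(** * Level 2 *)

Definition bipartition := (seq nat * seq nat)%type.

Definition rank (bl : bipartition) : nat := sumn bl.1 + sumn bl.2.

(* The boolean is the component: [false] is component 1, [true] component 2. *)
Definition binode := (node * bool)%type.

Definition component (bl : bipartition) (c : bool) : seq nat :=
  if c then bl.2 else bl.1.

Definition upd_component (bl : bipartition) (c : bool) (la : seq nat) :
    bipartition :=
  if c then (bl.1, la) else (la, bl.2).

Definition content (s : int * int) (g : binode) : int :=
  (g.1.2%:Z - g.1.1%:Z + (if g.2 then s.2 else s.1))%R.

Definition has_residue2 (d : nat) (s : int * int) (i : int) (g : binode) :
    bool :=
  (content s g == i %[mod d])%Z.

(* On equal contents component 2 precedes component 1. *)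
Definition prec (s : int * int) (g g' : binode) : bool :=
  (content s g < content s g')%R
  || (content s g == content s g') && (g'.2 < g.2).

Definition binodes_of (nodes : seq nat -> seq node) (bl : bipartition) :
    seq binode :=
  [seq (x, false) | x <- nodes bl.1] ++ [seq (x, true) | x <- nodes bl.2].

Definition signature2 (d : nat) (s : int * int) (i : int) (bl : bipartition) :
    seq (bool * binode) :=
  sort (fun u v => ~~ prec s v.2 u.2)
    [seq u <- letters (binodes_of addable_nodes bl)
                      (binodes_of removable_nodes bl)
       | has_residue2 d s i u.2].

Definition ftilde2 (d : nat) (s : int * int) (i : int) (bl : bipartition) :
    option bipartition :=
  omap (fun g => upd_component bl g.2 (add_node (component bl g.2) g.1))
    (good_addable (signature2 d s i bl)).

Definition etilde2 (d : nat) (s : int * int) (i : int) (bl : bipartition) :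
    option bipartition :=
  omap (fun g => upd_component bl g.2 (remove_node (component bl g.2) g.1))
    (good_removable (signature2 d s i bl)).

Definition fword2 (d : nat) (s : int * int) (w : seq int) :
    option bipartition :=
  foldr (fun i => obind (ftilde2 d s i)) (Some ([::], [::])) w.

Definition uglov (d : nat) (s : int * int) : set bipartition :=
  [set bl | exists w : seq int, fword2 d s w = Some bl]%classic.

(** * Crystal isomorphisms *)

Definition shift_charge (d : nat) (s : int * int) (j : nat) : int * int :=
  (s.1, s.2 + (j * d)%:Z)%R.

(* [psi] is the crystal isomorphism from [uglov d (s1, s2)] to
   [uglov d (s1, s2 + d)]; its values elsewhere are irrelevant. *)
Definition is_crystal_iso (d : nat) (s : int * int)
    (psi : bipartition -> bipartition) : Prop :=
  let s' := shift_charge d s 1 in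
  [/\ set_bij (uglov d s) (uglov d s') psi,
      forall bl, uglov d s bl -> rank (psi bl) = rank bl,
      forall i bl, uglov d s bl ->
        omap psi (ftilde2 d s i bl) = ftilde2 d s' i (psi bl)
    & forall i bl, uglov d s bl ->
        omap psi (etilde2 d s i bl) = etilde2 d s' i (psi bl)].

Fixpoint psi_comp (psi : nat -> int * int -> bipartition -> bipartition)
    (d : nat) (s : int * int) (k : nat) (bl : bipartition) : bipartition :=
  if k is j.+1 then psi d (shift_charge d s j) (psi_comp psi d s j bl) else bl.

(* The common value of [psi_comp psi d s k bl] for all large k. *)
Definition psi_tilde (psi : nat -> int * int -> bipartition -> bipartition)
    (d : nat) (s : int * int) (bl : bipartition) : bipartition :=
  xget bl [set mu | exists K : nat, forall k : nat,
                      K <= k -> psi_comp psi d s k bl = mu]%classic.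

(** * The maps Psi *)

(* Subsets of nat with r elements, as strictly increasing lists. *)
Definition in_P (r : nat) (X : seq nat) : bool := sorted ltn X && (size X == r).

(* The largest b in Y with b <= a if there is one, else the largest element of
   Y (for Y increasing). *)
Definition phi_pick (Y : seq nat) (a : nat) : nat :=
  last (last 0 Y) [seq b <- Y | b <= a].

(* The values phi(a_1), phi(a_2), ... in this order. *)
Fixpoint phi_values (X1 X2 : seq nat) : seq nat :=
  if X1 is a :: X1' then
    let b := phi_pick X2 a in b :: phi_values X1' (rem b X2)
  else [::].

(* The sizes (m1, m2) are those of the arguments. *)
Definition Psi (d : nat) (X : seq nat * seq nat) : seq nat * seq nat :=
  let Y1 := phi_values X.1 X.2 in
  (sort leq Y1,
   sort leq (undup ([seq a + d | a <- X.1]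
                    ++ [seq b + d | b <- X.2 & b \notin Y1] ++ iota 0 d))).

Definition statement_C : Prop :=
  forall d m k : nat, forall X : seq nat,
    0 < d -> in_P m X -> odd k ->
    let Y := iter k.+1 (Psi d) (X, X) in {subset Y.1 <= Y.2}.

(* Main.v *)
Require Import Defs.
From mathcomp Require Import all_boot all_order all_algebra zify.
From mathcomp Require Import boolp classical_sets functions.

Set Implicit Arguments.
Unset Strict Implicit.
Unset Printing Implicit Defensive.

(* Replace each component by the function counting its beta-numbers below y.
   Signatures are then read off one diagonal at a time, and the crystal
   isomorphism from charge (0, t) to (0, t + d), given by the maps Psi, moves U
   beads between the components, where U is the future minimum of the difference
   of the two counting functions.  It commutes with the f_i because on every
   diagonal the two-letter words before and after have the same reduced form.
   As a map on bipartitions it depends on t but not on d.  Starting from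
   (la, la), statement (C) says that in charge (0, 2ke) the beads of component 1
   are beads of component 2, so that the map is the identity there; hence the
   steps 0, e, 2e, ... of the e-crystal and the steps e, 3e, 5e, ... of the
   2e-crystal lead to the same bipartition.
   In a large charge (0, T) the crystal is a tensor product of level 1 crystals.
   If 2T = 0 mod d, negating all residues acts there componentwise by m_d, for
   d = e as well as for d = 2e.  In charge (0, 0) modulo e and in charge (0, e)
   modulo 2e, a word leading to (la, la) leads after negation to
   (m_e la, m_e la). *)
Import Order.TTheory GRing.Theory Num.Theory.

(** * Reduced words *)

(** The e-crystal and the 2e-crystal have different operators, so neither can be compared with the
    other step by step. What is followed instead is the value of one fixed word while the charge
    grows: a crystal isomorphism sends the value of a word to the value of the same word, so
    [psi_tilde] of a value is the value of that word in any reachable charge at least twice its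
    length. The two moduli meet only in the relation [transfer], which does not mention the modulus.
    Inclusion of the bead sets matters because it makes the difference of the counting functions
    nondecreasing, hence equal to its own future minimum. The condition 2T = 0 mod d has this
    origin: component 2 reads the residue i as i - T, and -i has to be read as -(i - T). The charge
    T = (2k + 1)e satisfies it for both moduli. The first equality is the coincidence of the two
    routes for m_e la; the other two come from negating residues in each modulus at the common end
    point of the routes for la. *)

Section Words.
Variable T : Type.
Implicit Types (w : seq (bool * T)) (x : T).

Definition numA w := count fst (reduce_word w).
Definition numR w := count (fun l => ~~ l.1) (reduce_word w).

(** [reduce_word] recurses from the right, whereas words are cut and concatenated below. This
    left-to-right reading keeps the number of R's not yet cancelled and the last A that met none, so
    concatenation becomes composition. *)
Definition scan_step (st : nat * option T) (l : bool * T) :=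
  if l.1 then (if st.1 is r.+1 then (r, st.2) else (0, Some l.2))
  else (st.1.+1, st.2).
Definition scan := foldl scan_step.

Lemma reduce_word_shape w : exists pa ra : seq T,
  reduce_word w = [seq (true, x) | x <- pa] ++ [seq (false, x) | x <- ra].
Proof.
elim: w => [|[b x] w [pa [ra E]]] /=; first by exists [::], [::].
rewrite E; case: b => /=; first by exists (x :: pa), ra.
case: pa {E} => [|y pa] /=; last by exists pa, ra.
by exists [::], (x :: ra); case: ra.
Qed.

Lemma count_shape (pa ra : seq T) :
  let w := [seq (true, x) | x <- pa] ++ [seq (false, x) | x <- ra] in
  [/\ count fst w = size pa, count (fun l => ~~ l.1) w = size ra
    & [seq l.2 | l <- w & l.1] = pa].
Proof.
rewrite /= !count_cat filter_cat map_cat; split.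
- by elim: pa => [|x pa IH] /=; [elim: ra | rewrite -addnA IH].
- elim: pa => [|x pa IH] /=; last by rewrite -addnA IH.
  by rewrite add0n; elim: ra => //= x ra ->.
- by elim: pa => [|x pa IH] /=; [elim: ra | rewrite IH].
Qed.

(** Reading R and then A restores every state, so cancelling a factor RA is invisible to [scan]. *)
Lemma scan_reduce st w : scan st (reduce_word w) = scan st w.
Proof.
elim: w st => [|[b x] w IH] st //=; rewrite -(IH (scan_step _ _)).
case: b => //=; case: (reduce_word w) => [|[[] y] r] //=.
by case: st.
Qed.

Lemma scan_shape (pa ra : seq T) r b :
  scan (r, b) ([seq (true, x) | x <- pa] ++ [seq (false, x) | x <- ra])
  = ((r - size pa) + size ra, if r < size pa then ohead (rev pa) else b).
Proof.
have scanR st : scan st [seq (false, x) | x <- ra] = (st.1 + size ra, st.2).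
  elim: ra st => [|x ra IH] [n o] /=; first by rewrite addn0.
  by rewrite IH /= addSnnS.
have scanA : scan (r, b) [seq (true, x) | x <- pa]
          = (r - size pa, if r < size pa then ohead (rev pa) else b).
  elim/last_ind: pa => [|pa x IH]; first by rewrite subn0.
  rewrite map_rcons -cats1 /scan foldl_cat -/scan IH size_rcons rev_rcons.
  rewrite /= /scan_step /=; case E: (r - size pa) => [|n] /=.
    have -> : r < (size pa).+1 by lia.
    by have -> : r - (size pa).+1 = 0 by lia.
  have -> : (r < (size pa).+1) = false by lia.
  have -> : (r < size pa) = false by lia.
  by have -> : r - (size pa).+1 = n by lia.
by rewrite /scan foldl_cat -/scan scanA scanR.
Qed.

Lemma scanE r b w : scan (r, b) w =
  ((r - numA w) + numR w, if r < numA w then good_addable w else b).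
Proof.
rewrite -scan_reduce /good_addable /numA /numR.
have [pa [ra ->]] := reduce_word_shape w.
by have [-> -> ->] := count_shape pa ra; rewrite scan_shape.
Qed.

Lemma scan_cat st w1 w2 : scan st (w1 ++ w2) = scan (scan st w1) w2.
Proof. exact: foldl_cat. Qed.

Lemma good_scan w : good_addable w = (scan (0, None) w).2.
Proof.
rewrite scanE /= /good_addable /numA; have [pa [ra ->]] := reduce_word_shape w.
by have [-> _ ->] := count_shape pa ra; case: pa.
Qed.

Lemma good_addable_gt0 w : isSome (good_addable w) = (0 < numA w).
Proof.
rewrite /good_addable /numA; have [pa [ra ->]] := reduce_word_shape w.
have [-> _ ->] := count_shape pa ra.
by case/lastP: pa => //= s x; rewrite size_rcons rev_rcons.
Qed.

(** The tensor product rule: the surviving R's of [w1] cancel surviving A's of [w2] from the left,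
    so the rightmost A lies in [w2] as long as one of them is left over. *)
Lemma good_addable_cat w1 w2 : good_addable (w1 ++ w2) =
  if numR w1 < numA w2 then good_addable w2 else good_addable w1.
Proof.
rewrite good_scan scan_cat !scanE /= sub0n add0n.
by case: ifP => // _; case: (good_addable w1) (good_addable_gt0 w1) => [?|] /= <- .
Qed.

Lemma numR_cat w1 w2 : numR (w1 ++ w2) = (numR w1 - numA w2) + numR w2.
Proof.
have := scan_cat (0, None) w1 w2.
by rewrite !scanE /= !sub0n !add0n => -[-> _].
Qed.

(** Each cancellation removes one A and one R, so the difference of their numbers is invariant. *)
Lemma numA_numR w :
  numA w + count (fun l => ~~ l.1) w = numR w + count fst w.
Proof.
rewrite /numA /numR; elim: w => [|[b x] w IH] //=.
case: b => /=; first by move: IH; lia.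
by case: (reduce_word w) IH => [|[[] y] r] /=; lia.
Qed.

Lemma numA_cat w1 w2 : numA (w1 ++ w2) = numA w1 + (numA w2 - numR w1).
Proof.
have := numA_numR (w1 ++ w2); have := numA_numR w1; have := numA_numR w2.
by rewrite numR_cat !count_cat; lia.
Qed.

Lemma numA1 (b : bool) x : numA [:: (b, x)] = b.
Proof. by case: b. Qed.

Lemma numR1 (b : bool) x : numR [:: (b, x)] = ~~ b.
Proof. by case: b. Qed.

(** The prefix reduces to A's and the suffix to R's; changing the letter in between to R therefore
    creates no cancellation, which [flip_mid] exploits. *)
Lemma good_addable_split w x : good_addable w = Some x ->
  exists w1 w2, [/\ w = w1 ++ (true, x) :: w2, numR w1 = 0 & numA w2 = 0].
Proof.
elim: w => [|l w IH] //; rewrite -cat1s good_addable_cat.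
case: ifP => H.
  move=> /IH [w1 [w2 [E R0 A0]]]; exists (l :: w1), w2; split=> //.
    by rewrite E.
  rewrite -cat1s numR_cat R0; move: H.
  by rewrite E -[_ :: w2]cat1s !numA_cat A0 R0 numA1 numR1; lia.
case: l H => -[] y //= H [<-]; exists [::], w; split=> //.
by move: H; rewrite numR1; lia.
Qed.

Lemma good_removable_split w : 0 < numR w ->
  exists w1 x w2, [/\ w = w1 ++ (false, x) :: w2, numR w1 = 0 & numA w2 = 0].
Proof.
elim: w => [|l w IH] //; rewrite -cat1s numR_cat => H.
have [R0|Rp] := posnP (numR w); last first.
  have {IH} [w1 [x [w2 [E R0 A0]]]] := IH Rp.
  have [H1|H1] := leqP (numR [:: l]) (numA w1).
    exists (l :: w1), x, w2; split=> //; first by rewrite E.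
    by rewrite -cat1s numR_cat R0; lia.
  exists [::]; case: l H H1 => -[] y H H1; first by move: H1; rewrite numR1.
  exists y, w; split=> //; move: H1.
  by rewrite E -[_ :: w2]cat1s !numA_cat A0 R0 !numA1 !numR1 /=; lia.
move: H; rewrite R0 addn0; case: l => -[] y; rewrite numR1 //= => H.
by exists [::], y, w; split=> //; move: H; lia.
Qed.

Lemma good_addable_mid w1 x w2 : numR w1 = 0 -> numA w2 = 0 ->
  good_addable (w1 ++ (true, x) :: w2) = Some x.
Proof.
move=> R0 A0; by rewrite -cat1s !good_addable_cat numA_cat R0 A0 numA1 numR1.
Qed.

Lemma flip_mid w1 x w2 : numR w1 = 0 -> numA w2 = 0 ->
  [/\ good_addable (w1 ++ (false, x) :: w2) = good_addable w1,
      numA (w1 ++ (true, x) :: w2) = (numA (w1 ++ (false, x) :: w2)).+1 &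
      numR (w1 ++ (false, x) :: w2) = (numR (w1 ++ (true, x) :: w2)).+1].
Proof.
move=> R0 A0; rewrite -[_ :: w2]cat1s -[(true, _) :: w2]cat1s.
rewrite !good_addable_cat !numA_cat !numR_cat R0 A0 !numA1 !numR1 /=.
by split=> //; lia.
Qed.

End Words.

Lemma reduce_word_map (T S : Type) (f : T -> S) w :
  reduce_word [seq (l.1, f l.2) | l <- w]
  = [seq (l.1, f l.2) | l <- reduce_word w].
Proof.
by elim: w => [|[[] x] w IH] //=; rewrite IH //; case: (reduce_word w) => [|[[] ?]].
Qed.

Lemma good_addable_map (T S : Type) (f : T -> S) w :
  good_addable [seq (l.1, f l.2) | l <- w] = omap f (good_addable w).
Proof.
rewrite /good_addable reduce_word_map; elim/last_ind: (reduce_word w) => //= s l.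
rewrite map_rcons !filter_rcons /=; case: l.1 => //=.
by rewrite !map_rcons !rev_rcons.
Qed.

Lemma numA_map (T S : Type) (f : T -> S) w :
  numA [seq (l.1, f l.2) | l <- w] = numA w.
Proof. by rewrite /numA reduce_word_map count_map. Qed.

Lemma numR_map (T S : Type) (f : T -> S) w :
  numR [seq (l.1, f l.2) | l <- w] = numR w.
Proof. by rewrite /numR reduce_word_map count_map. Qed.

(* Only the reduced form A^p R^q of a block is visible from outside it. *)
Lemma good_addable_blocks (I : eqType) (T S : Type) (F : I -> seq (bool * T))
    (G : I -> seq (bool * S)) (s : seq I) :
    {in s, forall i, numA (F i) = numA (G i) /\ numR (F i) = numR (G i)} ->
  let w := flatten [seq F i | i <- s] in
  let w' := flatten [seq G i | i <- s] in
  [/\ numA w = numA w', numR w = numR w' &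
   good_addable w = None \/
   exists i, [/\ i \in s, good_addable w = good_addable (F i),
     good_addable w' = good_addable (G i) & 0 < numA (F i)]].
Proof.
elim: s => [|i s IH] H /=; first by split=> //; left.
have /IH [EA ER E] : {in s, forall k, numA (F k) = numA (G k) /\ numR (F k) = numR (G k)}.
  by move=> k ks; apply: H; rewrite inE ks orbT.
have [Ai Ri] := H i (mem_head i s).
rewrite !numA_cat !numR_cat !good_addable_cat; split; rewrite ?Ai ?Ri ?EA ?ER //.
case: ifP => _.
  by case: E => [|[k [ks E1 E2 A0]]]; [left | right; exists k; rewrite inE ks orbT].
have [A0|A0] := posnP (numA (F i)).
  by left; have := good_addable_gt0 (F i); rewrite A0; case: good_addable.
by right; exists i; rewrite mem_head.
Qed.

(** * Bead counts *)

Lemma sorted_geqP (s : seq nat) :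
  reflect (forall i, nth 0 s i.+1 <= nth 0 s i) (sorted geq s).
Proof.
apply: (iffP (sortedP 0)) => H i; last by move=> _; exact: H.
by have [/H//|/(nth_default 0)->] := ltnP i.+1 (size s).
Qed.

Lemma partition_nth la i : is_partition la -> nth 0 la i.+1 <= nth 0 la i.
Proof. by case/andP => /sorted_geqP. Qed.

Lemma partition_nth_le la i j : is_partition la -> i <= j ->
  nth 0 la j <= nth 0 la i.
Proof.
move=> P /subnK <-; elim: (j - i) => // k IH.
exact: leq_trans (partition_nth _ P) IH.
Qed.

Lemma partition_gt0 la i : is_partition la -> (0 < nth 0 la i) = (i < size la).
Proof.
case/andP => _ H0; have [H|/(nth_default 0)->] := ltnP i (size la); rewrite ?ltnn //.
by rewrite lt0n; apply: contraNneq H0 => <-; rewrite mem_nth.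
Qed.

Lemma partition_eq la la' : is_partition la -> is_partition la' ->
  (forall i, nth 0 la i = nth 0 la' i) -> la = la'.
Proof.
move=> P P' H; apply: (@eq_from_nth _ 0) => [|i _]; last exact: H.
apply/eqP; rewrite eqn_leq; apply/andP; split; rewrite leqNgt; apply/negP.
  by rewrite -partition_gt0 // H partition_gt0 // ltnn.
by rewrite -partition_gt0 // -H partition_gt0 // ltnn.
Qed.

Lemma size_le_sumn la : is_partition la -> size la <= sumn la.
Proof.
case/andP => _; elim: la => [|x la IH] //=; rewrite inE negb_or => /andP [x0 /IH].
by case: x x0 => //= n _; lia.
Qed.

Lemma nth_le_sumn la i : nth 0 la i <= sumn la.
Proof.
elim: la i => [|x la IH] [|i] //=; first exact: leq_addr.
exact: leq_trans (IH i) (leq_addl _ _).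
Qed.

Lemma nth_filter_neq0 (s : seq nat) i : sorted geq s ->
  nth 0 [seq p <- s | p != 0] i = nth 0 s i.
Proof.
elim: s i => [|x s IH] i //= xs; have {}IH := IH _ (path_sorted xs).
case: x xs => [|x] xs /=; last by case: i => //=.
have Z k : nth 0 s k = 0.
  have [ks|/(nth_default 0)//] := ltnP k (size s).
  have tr : transitive geq by move=> a b c; exact: (fun p q => leq_trans q p).
  by have /(order_path_min tr)/(all_nthP 0)/(_ k ks) := xs; rewrite /= leqn0 => /eqP.
by rewrite IH Z; case: i => //= i; rewrite Z.
Qed.

(* The number of beta-numbers la_a + M - a - 1 (a < M) that are less than y. *)
Definition cnt (M : nat) (la : seq nat) (y : nat) : nat :=
  count (fun a => nth 0 la a + M <= y + a) (iota 0 M).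

Lemma cnt_le M la y : cnt M la y <= M.
Proof. by rewrite -[X in _ <= X](size_iota 0 M) count_size. Qed.

Lemma count_monotone (p : pred nat) M a : (forall b, p b -> p b.+1) -> a < M ->
  p a = (M <= count p (iota 0 M) + a).
Proof.
move=> mono aM.
have mono2 b c : b <= c -> p b -> p c.
  by move=> /subnK <-; elim: (c - b) => // k IH /IH /mono.
rewrite -{2}(subnKC (ltnW aM)) iotaD count_cat add0n.
have s1 := count_size p (iota 0 a); have s2 := count_size p (iota a (M - a)).
rewrite !size_iota in s1 s2; case pa: (p a).
  have /eqP -> : count p (iota a (M - a)) == size (iota a (M - a)).
    rewrite -all_count; apply/allP => b; rewrite mem_iota => /andP [ab _]; exact: mono2 ab pa.
  by rewrite size_iota; lia.
have -> : count p (iota 0 a) = 0.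
  apply/eqP; rewrite -leqn0 leqNgt -has_count; apply/negP => /hasP [b].
  rewrite mem_iota add0n => /andP [_ ba] pb.
  by rewrite (mono2 _ _ (ltnW ba) pb) in pa.
case E: (M - a) => [|k] /=; first by lia.
by rewrite pa; have := count_size p (iota a.+1 k); rewrite size_iota; lia.
Qed.

(** Beta-numbers decrease as the row grows, so those below [y] belong to the last [cnt M la y] of
    the [M] rows. With the converse [cntP], this turns statements about bead counts into linear
    arithmetic. *)
Lemma cntG M la y a : is_partition la -> size la <= M ->
  (nth 0 la a + M <= y + a) = (M <= cnt M la y + a).
Proof.
move=> P sM; have [aM|aM] := ltnP a M.
  rewrite /cnt (@count_monotone (fun a => nth 0 la a + M <= y + a) M a) // => b.
  by have := partition_nth b P; lia.
rewrite nth_default; last exact: leq_trans aM.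
by lia.
Qed.

Lemma cntP M la y C : is_partition la -> size la <= M -> C <= M ->
  (forall a, (nth 0 la a + M <= y + a) = (M <= C + a)) -> cnt M la y = C.
Proof.
move=> P sM CM H; have E a : (M <= cnt M la y + a) = (M <= C + a).
  by rewrite -cntG.
have := cnt_le M la y; move: (E (M - C)) (E (M - cnt M la y)); lia.
Qed.

Definition steps (C : nat -> nat) := forall y, C y <= C y.+1 <= (C y).+1.

Lemma cnt_steps M la : is_partition la -> size la <= M -> steps (cnt M la).
Proof.
move=> P sM y; have := cnt_le M la y; have := cnt_le M la y.+1.
set c := cnt M la y; set c' := cnt M la y.+1 => c'M cM.
have G a := cntG y a P sM; have G' a := cntG y.+1 a P sM.
apply/andP; split; first by move: (G (M - c)) (G' (M - c)); lia.
move: (G (M - c')) (G' (M - c')) (G (M - c').+1) (G' (M - c').+1) (partition_nth (M - c') P).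
by rewrite -/c -/c'; lia.
Qed.

Lemma cnt_low M la y : is_partition la -> y + size la <= M -> cnt M la y = y.
Proof.
move=> P sM; apply: cntP => // [||a]; [lia | lia |].
have [H|H] := ltnP a (size la); first by have := partition_gt0 a P; lia.
by rewrite nth_default //; lia.
Qed.

Lemma cnt_high M la y : is_partition la -> size la <= M ->
  M + nth 0 la 0 <= y -> cnt M la y = M.
Proof.
move=> P sM yM; apply: cntP => // a; have := partition_nth_le P (leq0n a); lia.
Qed.

Lemma cnt_shift M d la y : is_partition la -> size la <= M ->
  cnt (M + d) la (y + d) = cnt M la y + d.
Proof.
move=> P sM; apply: cntP => // [||a]; [lia | by have := cnt_le M la y; lia |].
by have := cntG y a P sM; lia.
Qed.

Lemma cnt_inj M la la' : is_partition la -> is_partition la' ->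
  size la <= M -> size la' <= M -> cnt M la =1 cnt M la' -> la = la'.
Proof.
move=> P P' sM sM' H; apply: partition_eq => // a.
have G y := cntG y a P sM; have G' y := cntG y a P' sM'.
have [aM|aM] := leqP M a; first by rewrite !nth_default //; lia.
move: (G (nth 0 la a + M - a)) (G' (nth 0 la a + M - a)).
by move: (G (nth 0 la' a + M - a)) (G' (nth 0 la' a + M - a)); rewrite !H; lia.
Qed.

Definition bead (C : nat -> nat) (j : nat) := C j < C j.+1.

(* The letter carried by the diagonal through position j: a bead at j that can
   move to j + 1 is an addable node, and conversely for removable nodes. *)
Definition sgn (C : nat -> nat) (j : nat) : option bool :=
  if bead C j == bead C j.+1 then None else Some (bead C j).

(** The row is the number of beads beyond [j + 1], which is right for addable and removable nodes
    alike; the column then follows from the content. *)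
Definition nodeat (M : nat) (C : nat -> nat) (j : nat) : node :=
  (M - C j.+2, j.+1 + (M - C j.+2) - M).

Lemma eq_sgn C C' j : C j = C' j -> C j.+1 = C' j.+1 -> C j.+2 = C' j.+2 ->
  sgn C j = sgn C' j.
Proof. by rewrite /sgn /bead => -> -> ->. Qed.

Lemma sgnP C j b : steps C -> sgn C j = Some b <->
  if b then C j.+1 = (C j).+1 /\ C j.+2 = (C j).+1
  else C j.+1 = C j /\ C j.+2 = (C j).+1.
Proof.
move=> st; move: (st j) (st j.+1); rewrite /sgn /bead.
case: b; case: (ltnP (C j)) => ?; case: (ltnP (C j.+1)) => /= ???;
  by split=> //; try lia; move=> ?; exfalso; lia.
Qed.

Lemma mem_letters (T : eqType) (adds rems : seq T) b x :
  ((b, x) \in letters adds rems) = if b then x \in adds else x \in rems.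
Proof.
have inj (c : bool) : injective (fun x : T => (c, x)) by move=> ? ? [].
rewrite mem_cat; case: b; rewrite (mem_map (inj _)).
  by case: (x \in adds) => //=; apply/negP => /mapP [].
by case: (x \in rems); rewrite ?orbT ?orbF //; apply/negP => /mapP [].
Qed.

Lemma uniq_letters (T : eqType) (adds rems : seq T) :
  uniq adds -> uniq rems -> uniq (letters adds rems).
Proof.
move=> ua ur; rewrite cat_uniq !map_inj_uniq; try by move=> ? ? [].
rewrite ua ur andbT /=; apply/hasPn => -[b x] /mapP [y _ [-> _]].
by apply/mapP => -[].
Qed.

Section NodeTests.
Variable la : seq nat.
Hypothesis P : is_partition la.

Lemma addableE a b : addable la (a, b) =
  (b == nth 0 la a) && ((a == 0) || (nth 0 la a < nth 0 la a.-1)).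
Proof.
rewrite /addable /=; congr (_ && _); apply/sorted_geqP/orP.
  move=> H; case: a H => [|a] H; [by left | right].
  by have := H a; rewrite !nth_incr_nth /= eqxx; case: eqP; lia.
move=> H i; rewrite !nth_incr_nth; have := partition_nth i P.
by case: (a =P i.+1) H => [->|_] /= [] //; lia.
Qed.

Lemma removableE a b : removable la (a, b) =
  (b.+1 == nth 0 la a) && (nth 0 la a.+1 < nth 0 la a).
Proof.
rewrite /removable /=; case: eqP => //= E; apply/sorted_geqP/idP.
  by move=> H; have := H a; rewrite !nth_set_nth /= eqxx gtn_eqF // -E ltnS.
move=> H i; rewrite !nth_set_nth /=; have := partition_nth i P.
case: (i.+1 =P a) => [E2|_]; case: (i =P a) => [E3|_] //.
  by rewrite E2 -E; lia.
by rewrite E3; lia.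
Qed.

Lemma addable_nodesE x :
  x \in addable_nodes la = addable la x.
Proof.
rewrite mem_filter; case: x => a b; case A: (addable _ _); rewrite ?andFb ?andTb //.
move: A; rewrite addableE // => /andP [/eqP -> H]; apply/mapP; exists a => //.
rewrite mem_iota /= add0n ltnS leqNgt; apply/negP => a_gt.
by move: H; rewrite [nth 0 la a.-1]nth_default; lia.
Qed.

Lemma removable_nodesE x :
  x \in removable_nodes la = removable la x.
Proof.
rewrite mem_filter; case: x => a b; case A: (removable _ _); rewrite ?andFb ?andTb //.
move: A; rewrite removableE // => /andP [/eqP E H]; apply/mapP; exists a.
  by rewrite mem_iota /= add0n -partition_gt0 // -E.
by rewrite -E.
Qed.

End NodeTests.

Section Nodes.
Variables (M : nat) (la : seq nat).
Hypotheses (P : is_partition la) (sM : size la < M).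
Let C := cnt M la.

Let Cst : steps C. Proof. exact: cnt_steps (ltnW sM). Qed.
Let CM y : C y <= M. Proof. exact: cnt_le. Qed.
Let G y a : (nth 0 la a + M <= y + a) = (M <= C y + a).
Proof. exact: cntG (ltnW sM). Qed.

Lemma sgn_bounds j b : sgn C j = Some b -> M <= j.+1 + size la /\ j < M + nth 0 la 0.
Proof.
move=> /(sgnP _ _ Cst) H; split; rewrite leqNgt; apply/negP => jM.
  by case: b H; rewrite /C !cnt_low //; lia.
have h y : j <= y -> C y = M by move=> jy; apply: cnt_high => //; lia.
by case: b H; rewrite !h; lia.
Qed.

Lemma letter_nodesP b x :
  (b, x) \in letters (addable_nodes la) (removable_nodes la) <->
  exists2 j, sgn C j = Some b & x = nodeat M C j.
Proof.
case: x => a c.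
have -> : (b, (a, c)) \in letters (addable_nodes la) (removable_nodes la)
        = if b then addable la (a, c) else removable la (a, c).
  by rewrite mem_letters addable_nodesE // removable_nodesE.
split.
  case: b.
    rewrite addableE // => /andP [/eqP -> H].
    have aM : a < M.
      by rewrite ltnNge; apply/negP => Ma; move: H; rewrite !nth_default; lia.
    (* The bead of row [a] is at la_a + M - a - 1; an addable node moves it up from there. *)
    have [j Ej] : exists j, j.+1 + a = nth 0 la a + M.
      by exists (nth 0 la a + M - a.+1); lia.
    have H1 := CM j.+2; have H2 := Cst j; have H3 := Cst j.+1.
    have G0 := G j a; have G1 := G j.+1 a; have G2 := G j.+2 a.-1.
    exists j; first by apply/(sgnP _ _ Cst) => /=; lia.
    by rewrite /nodeat; congr (_, _); lia.
  rewrite removableE // => /andP [/eqP E H].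
  have aM : a < M.
    by rewrite ltnNge; apply/negP => Ma; move: H; rewrite !nth_default; lia.
  (* For a removable node the bead of row [a] is the upper end of the move, at [j + 1]. *)
  have [j Ej] : exists j, j.+2 + a = nth 0 la a + M.
    by exists (nth 0 la a + M - a.+2); lia.
  have H1 := CM j.+2; have H2 := Cst j; have H3 := Cst j.+1.
  have G0 := G j a; have G1 := G j.+1 a; have G2 := G j.+2 a.
  have G3 := G j a.+1; have G4 := G j.+1 a.+1.
  exists j; first by apply/(sgnP _ _ Cst) => /=; lia.
  by rewrite /nodeat; congr (_, _); lia.
case=> j sj [Ea Ec]; have [jM1 jM2] := sgn_bounds sj.
move: sj => /(sgnP _ _ Cst); have := CM j.+2.
case: b => CMj [E1 E2].
  rewrite addableE //; move: (G j a) (G j.+1 a) (G j.+2 a.-1); lia.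
rewrite removableE //; move: (G j.+1 a) (G j.+2 a) (G j a.+1) (G j.+1 a.+1) ; lia.
Qed.

End Nodes.

Lemma sumn_incr_nth la a : sumn (incr_nth la a) = (sumn la).+1.
Proof.
elim: la a => [|x la IH] [|a] //=; last by rewrite IH addnS.
by rewrite /incr_nth /= sumn_ncons /= mul0n.
Qed.

Lemma letters_uniq la : uniq (letters (addable_nodes la) (removable_nodes la)).
Proof.
have U (f : nat -> nat) p n : uniq [seq x <- [seq (a, f a) | a <- iota 0 n] | p x].
  by apply: filter_uniq; rewrite map_inj_uniq ?iota_uniq // => a b [].
by apply: uniq_letters; exact: U.
Qed.

Lemma addable_partition la a b : is_partition la -> addable la (a, b) ->
  is_partition (incr_nth la a).
Proof.
move=> P /andP [_ /= A]; rewrite /is_partition A /=.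
apply/negP => /(nthP 0) [i]; rewrite size_incr_nth nth_incr_nth.
have := partition_gt0 i P; move: A => /sorted_geqP /(_ a.-1).
rewrite !nth_incr_nth; have := partition_gt0 a P; have := partition_gt0 a.-1 P.
by case: (ltnP a (size la)) => Ha; case: a Ha => [|a] /=; lia.
Qed.

Section AddNode.
Variables (M : nat) (la : seq nat) (j : nat).
Hypotheses (P : is_partition la) (sM : sumn la < M).
Let C := cnt M la.

Let sizeM : size la < M.
Proof. exact: leq_ltn_trans (size_le_sumn P) sM. Qed.
Let Cst : steps C. Proof. exact: cnt_steps (ltnW sizeM). Qed.
Let CM y : C y <= M. Proof. exact: cnt_le. Qed.
Let G y a : (nth 0 la a + M <= y + a) = (M <= C y + a).
Proof. exact: cntG (ltnW sizeM). Qed.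

Lemma add_nodeP : sgn C j = Some true ->
  let la' := add_node la (nodeat M C j) in
  [/\ is_partition la', sumn la' = (sumn la).+1
    & forall y, cnt M la' y = C y - (y == j.+1)].
Proof.
move=> sj la'.
have [jM1 jM2] := sgn_bounds P sizeM sj.
have A : addable la (nodeat M C j).
  rewrite -addable_nodesE //.
  have : (true, nodeat M C j) \in letters (addable_nodes la) (removable_nodes la).
    by apply/(letter_nodesP P sizeM); exists j.
  by rewrite mem_letters.
move: sj => /(sgnP _ _ Cst) [E1 E2].
have S : sumn la' = (sumn la).+1 by exact: sumn_incr_nth.
have P' : is_partition la'.
  exact: (@addable_partition _ _ (nodeat M C j).2 P A).
split=> // y; apply: cntP => //.
- by apply: leq_trans (size_le_sumn P') _; rewrite S.
- by have := CM y; lia.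
move=> b; rewrite nth_incr_nth.
have := CM y; have := CM j.+1; have := CM j; have := CM j.+2.
move: (G y b) (G j (M - C j.+2)) (G j.+1 (M - C j.+2)); rewrite /nodeat /=.
case: (y =P j.+1) => [->|ny] /=; case: eqP => [<-|nb]; rewrite ?E1 ?E2; lia.
Qed.

Lemma remove_nodeP : sgn C j = Some false -> exists la',
  [/\ is_partition la', sumn la = (sumn la').+1,
      forall y, cnt M la' y = C y + (y == j.+1)
    & add_node la' (nodeat M (cnt M la') j) = la].
Proof.
move=> sj; have [jM1 jM2] := sgn_bounds P sizeM sj.
set a := M - C j.+2.
have [b A] : exists b, removable la (a, b).
  exists (nodeat M C j).2.
  rewrite -removable_nodesE //.
  have : (false, nodeat M C j) \in letters (addable_nodes la) (removable_nodes la).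
    by apply/(letter_nodesP P sizeM); exists j.
  by rewrite mem_letters.
have := A; rewrite removableE // => /andP [/eqP E2 _].
move: A sj => /andP [_ /= A] /(sgnP _ _ Cst) [E0 E1].
have Eb : j.+2 + a = b.+1 + M.
  by have := G j.+1 a; have := G j.+2 a; have := CM j.+2; rewrite E2; lia.
pose la' := [seq p <- set_nth 0 la a b | p != 0].
have N i : nth 0 la' i = if i == a then b else nth 0 la i.
  by rewrite nth_filter_neq0 // nth_set_nth.
have P' : is_partition la'.
  rewrite /is_partition sorted_filter //; first by rewrite mem_filter.
  by move=> x y z; exact: (fun p q => leq_trans q p).
have E : incr_nth la' a = la.
  apply: partition_eq => // [|i]; last first.
    by rewrite nth_incr_nth N eq_sym; case: eqP => [->|] //; rewrite -E2.
  apply: (@addable_partition _ _ b) => //; rewrite addableE // !N eqxx eqxx /=.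
  by case: (a) E2 => //= k; have := partition_nth k P; case: eqP; lia.
have S : sumn la = (sumn la').+1 by rewrite -(sumn_incr_nth _ a) E.
have C' y : cnt M la' y = C y + (y == j.+1).
  apply: cntP => //; first by have := size_le_sumn P'; lia.
    by have := CM y; have := CM j.+2; case: eqP => [->|]; lia.
  move=> i; rewrite N; have := CM j.+2; have := CM y.
  move: (G y i) (G j.+1 i) (G j.+1 a) (G j.+2 a).
  by case: (y =P j.+1) => [->|ny]; case: (i =P a) => [->|na]; lia.
exists la'; split=> //; rewrite /add_node /= C'.
have -> : (j.+2 == j.+1) = false by lia.
by rewrite addn0; exact: E.
Qed.

End AddNode.

(** * Signatures along diagonals *)

(** [leT] is only a preorder, but strictly increasing keys in [s2] exclude ties, so the sorted
    permutation is unique. *)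
Lemma sort_by_key (T : eqType) (key : T -> int) (leT : rel T) (s1 s2 : seq T) :
    leT =2 (fun u v => (key u <= key v)%R) -> uniq s1 -> s1 =i s2 ->
    sorted (fun u v => (key u < key v)%R) s2 ->
  sort leT s1 = s2.
Proof.
move=> leE u1 E s2_sorted.
have lt_tr : transitive (fun u v => (key u < key v)%R).
  by move=> x y z; exact: lt_trans.
have u2 : uniq s2.
  by apply: (sorted_uniq lt_tr _ s2_sorted) => x /=; rewrite ltxx.
have uk : uniq (map key s2).
  apply: (@sorted_uniq _ <%R) => [x y z|x|]; [exact: lt_trans|exact: ltxx|].
  by rewrite sorted_map.
have tot : total leT by move=> x y; rewrite !leE; exact: le_total.
apply: (@sorted_eq_in _ leT); last by rewrite perm_sort; exact: uniq_perm.
- by move=> x y z _ _ _; rewrite !leE; exact: le_trans.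
- move=> x y; rewrite !mem_sort !E !leE => xs ys /le_anti H.
  have [nx ny] := (nth_index x xs, nth_index x ys); rewrite -nx -ny.
  congr nth; apply/eqP; rewrite -(nth_uniq (key x) _ _ uk) ?size_map ?index_mem //.
  by rewrite !(nth_map x) ?index_mem // nx ny H.
- exact: sort_sorted.
by apply: sub_sorted s2_sorted => x y; rewrite leE; exact: ltW.
Qed.

Section WordOf.
Variables (T : eqType) (sg : T -> option bool).

Definition word (s : seq T) : seq (bool * T) :=
  pmap (fun x => omap (fun b => (b, x)) (sg x)) s.

Lemma word_cat s1 s2 : word (s1 ++ s2) = word s1 ++ word s2.
Proof. exact: pmap_cat. Qed.

Lemma word_flatten ss : word (flatten ss) = flatten [seq word s | s <- ss].
Proof. by elim: ss => //= s ss IH; rewrite word_cat IH. Qed.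

Lemma mem_word b x s : ((b, x) \in word s) = (x \in s) && (sg x == Some b).
Proof.
rewrite mem_pmap; apply/mapP/andP.
  by case=> y ys; case E: (sg y) => [c|] //= [-> ->]; rewrite E eqxx.
by case=> xs /eqP E; exists x; rewrite ?E.
Qed.

Lemma word_tags s : [seq l.2 | l <- word s] = [seq x <- s | isSome (sg x)].
Proof. by elim: s => //= x s IH; case: (sg x) => //= b; rewrite IH. Qed.

Lemma sorted_word (r : rel T) s : sorted r [seq x <- s | isSome (sg x)] ->
  sorted (fun u v : bool * T => r u.2 v.2) (word s).
Proof. by rewrite -word_tags sorted_map. Qed.

End WordOf.

Lemma eq_in_word (T : eqType) (f g : T -> option bool) s :
  {in s, f =1 g} -> word f s = word g s.
Proof.
elim: s => //= x s IH H; rewrite H ?mem_head // IH // => y ys.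
by apply: H; rewrite inE ys orbT.
Qed.

Lemma word_map (T S : eqType) (f : S -> option bool) (h : T -> S) s :
  word f (map h s) = [seq (l.1, h l.2) | l <- word (f \o h) s].
Proof. by elim: s => //= x s IH; case: (f (h x)) => //= b; rewrite IH. Qed.

(* Position j with M beads corresponds to content j + 1 - M. *)
Definition res (M d : nat) (i : int) (j : nat) : bool :=
  (j.+1%:Z - M%:Z == i %[mod d])%Z.

(** Neighbouring positions have different residues since [d] is at least 2. Hence moving a bead on
    one diagonal of a class does not disturb the letters on the others. *)
Lemma res_gap M d i j j' : 2 <= d -> res M d i j -> res M d i j' -> j < j' ->
  j.+2 <= j'.
Proof.
move=> d2; rewrite /res => /eqP <- /eqP/eqP; rewrite eqz_mod_dvd => H jj'.
rewrite ltn_neqAle jj' andbT; apply/eqP => E; move: H; rewrite -E.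
have -> : (j.+2%:Z - M%:Z - (j.+1%:Z - M%:Z) = 1)%R by lia.
by rewrite dvdz1 /= ; lia.
Qed.

Definition class M d i N := [seq j <- iota 0 N | res M d i j].

Lemma class_sorted M d i N : sorted ltn (class M d i N).
Proof. by apply: sorted_filter; [exact: ltn_trans | exact: iota_ltn_sorted]. Qed.

Lemma mem_class M d i N j : (j \in class M d i N) = (j < N) && res M d i j.
Proof. by rewrite mem_filter mem_iota add0n andbC. Qed.

Lemma steps_le C x y : steps C -> x <= y -> C x <= C y.
Proof.
move=> st /subnK <-; elim: (y - x) => // k IH; apply: leq_trans IH _.
by rewrite addSn; case/andP: (st (k + x)).
Qed.

Lemma cnt_le_id M la y : is_partition la -> size la <= M -> cnt M la y <= y.
Proof.
move=> P sM; elim: y => [|y IH]; first by rewrite cnt_low.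
by have := cnt_steps P sM y; lia.
Qed.

Lemma nodeat_content M la j b : is_partition la -> size la < M ->
  sgn (cnt M la) j = Some b ->
  ((nodeat M (cnt M la) j).2%:Z - (nodeat M (cnt M la) j).1%:Z
   = j.+1%:Z - M%:Z)%R.
Proof.
move=> P sM; have st := cnt_steps P (ltnW sM).
move=> /(sgnP _ _ st) H; have := cnt_le_id j P (ltnW sM); rewrite /nodeat /=.
by have := cnt_le M la j.+2; case: b H; lia.
Qed.

Lemma sgn_lt M la j b N : is_partition la -> sumn la < M -> M.*2 <= N ->
  sgn (cnt M la) j = Some b -> j < N.
Proof.
move=> P sM MN; have sizeM := leq_ltn_trans (size_le_sumn P) sM.
by move=> /(sgn_bounds P sizeM) [_]; have := nth_le_sumn la 0; lia.
Qed.

Lemma signature1E M N d i la : is_partition la -> sumn la < M -> M.*2 <= N ->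
  2 <= d ->
  signature1 d i la = [seq (l.1, nodeat M (cnt M la) l.2)
                      | l <- word (sgn (cnt M la)) (class M d i N)].
Proof.
move=> P sM MN d2.
have sizeM : size la < M by exact: leq_ltn_trans (size_le_sumn P) sM.
have st := cnt_steps P (ltnW sizeM).
apply: (@sort_by_key _ (fun u => - (u.2.1)%:Z)%R).
- by move=> u v /=; lia.
- exact/filter_uniq/letters_uniq.
- move=> [b x]; rewrite mem_filter /=; apply/andP/mapP.
    case=> R /(letter_nodesP P sizeM) [j sj Ex].
    exists (b, j); last by rewrite Ex.
    rewrite mem_word sj eqxx andbT mem_class (sgn_lt P sM MN sj) /=.
    by move: R; rewrite /has_residue1 Ex (nodeat_content P sizeM sj).
  case=> -[b' j] /=; rewrite mem_word mem_class.
  case/andP => /andP [jN R] /eqP sj [-> ->].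
  split; last by apply/(letter_nodesP P sizeM); exists j.
  by rewrite /has_residue1 (nodeat_content P sizeM sj).
rewrite sorted_map; set C := cnt M la.
apply: (sorted_word (r := fun j j' => ((- (nodeat M C j).1%:Z < - (nodeat M C j').1%:Z)%R))).
apply: (@sub_in_sorted _ [pred j | (j \in class M d i N) && isSome (sgn C j)] ltn); last first.
- by apply: sorted_filter; [exact: ltn_trans | exact: class_sorted].
- by apply/allP => j; rewrite mem_filter inE andbC.
move=> j j'; rewrite !inE !mem_class => /andP [/andP [_ R] _] /andP [/andP [_ R'] S'].
(* The letter at [j'] forces C (j' + 2) = C j' + 1, which exceeds C (j + 2); so the row strictly
   drops from one letter to the next. *)
move=> /(res_gap d2 R R') jj' /=; case E: (sgn C j') S' => [b|] // _.
move: E => /(sgnP _ _ st); have := steps_le st jj'; have := st j'.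
by have := cnt_le M la j'.+2; rewrite -/C; case: b; lia.
Qed.

(* Twice the content leaves room for breaking ties by component. *)
Definition slot_key (off : bool -> nat) (s : int * int) (x : nat * bool) : int :=
  (2 * (x.1.+1%:Z - (off x.2)%:Z + (if x.2 then s.2 else s.1))
   + (~~ x.2)%:Z)%R.

Definition slot_res (off : bool -> nat) (s : int * int) (d : nat) (i : int) (x : nat * bool) :=
  (x.1.+1%:Z - (off x.2)%:Z + (if x.2 then s.2 else s.1) == i %[mod d])%Z.

Definition sgn2 (off : bool -> nat) (bl : bipartition) (x : nat * bool) :=
  sgn (cnt (off x.2) (component bl x.2)) x.1.

Definition binodeat (off : bool -> nat) (bl : bipartition) (x : nat * bool) : binode :=
  (nodeat (off x.2) (cnt (off x.2) (component bl x.2)) x.1, x.2).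

Lemma mem_binodes f (bl : bipartition) x c :
  ((x, c) \in binodes_of f bl) = (x \in f (component bl c)).
Proof.
have inj (b : bool) : injective (fun x : node => (x, b)) by move=> ? ? [].
rewrite mem_cat; case: c; rewrite /= (mem_map (inj _)).
  by case: (x \in f bl.2); rewrite ?orbT ?orbF //; apply/negP => /mapP [].
by case: (x \in f bl.1) => //=; apply/negP => /mapP [].
Qed.

Lemma uniq_binodes f (bl : bipartition) : (forall la, uniq (f la)) ->
  uniq (binodes_of f bl).
Proof.
move=> u; rewrite cat_uniq !map_inj_uniq; try by move=> ? ? [].
rewrite !u andbT /=; apply/hasPn => -[x c] /mapP [y _ [_ ->]].
by apply/mapP => -[].
Qed.

(** The list [S] of slots is left free because signatures are read in four ways below: diagonal by
    diagonal in either order of the components, with one slot per diagonal modulo 2e, and one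
    component after the other. *)
Lemma signature2E off s d i bl (S : seq (nat * bool)) :
    (forall c, is_partition (component bl c) /\ sumn (component bl c) < off c) ->
    sorted (fun x y => (slot_key off s x < slot_key off s y)%R) S ->
    (forall x, isSome (sgn2 off bl x) -> (x \in S) = slot_res off s d i x) ->
  signature2 d s i bl
    = [seq (l.1, binodeat off bl l.2) | l <- word (sgn2 off bl) S].
Proof.
move=> H S_sorted SP.
have P c : is_partition (component bl c) by case: (H c).
have sizeM c : size (component bl c) < off c.
  by case: (H c) => _; exact: leq_ltn_trans (size_le_sumn (P c)).
apply: (@sort_by_key _ (fun u => 2 * content s u.2 + (~~ u.2.2)%:Z)%R).
- move=> [b [x c]] [b' [x' c']]; rewrite /prec /=.
  by case: c; case: c' => /=; lia.
- by apply/filter_uniq/uniq_letters; apply: uniq_binodes => la;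
    have /= := letters_uniq la; rewrite cat_uniq => /and3P [u1 _ u2];
    [exact: map_uniq u1 | exact: map_uniq u2].
- move=> [b [x c]]; rewrite mem_filter mem_letters !mem_binodes -mem_letters.
  apply/andP/mapP.
    case=> R /(letter_nodesP (P c) (sizeM c)) [j sj Ex].
    exists (b, (j, c)); last by rewrite Ex.
    rewrite mem_word /sgn2 sj eqxx andbT SP /sgn2 ?sj // /slot_res.
    move: R; rewrite /has_residue2 /content Ex /=.
    by rewrite (nodeat_content (P c) (sizeM c) sj).
  case=> -[b' [j c']]; rewrite mem_word => /andP [jS /eqP sj] [-> -> ->].
  split; last by apply/(letter_nodesP (P c') (sizeM c')); exists j.
  move: jS; rewrite SP ?sj // /slot_res /has_residue2 /content.
  by rewrite (nodeat_content (P c') (sizeM c') sj).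
rewrite sorted_map.
apply: (sorted_word (r := relpre (binodeat off bl) (fun g g' =>
  (2 * content s g + (~~ g.2)%:Z < 2 * content s g' + (~~ g'.2)%:Z)%R))).
apply: (@sub_in_sorted _ [pred x | isSome (sgn2 off bl x)]
  (fun x y => (slot_key off s x < slot_key off s y)%R)); last first.
- by apply: sorted_filter => // x y z; exact: lt_trans.
- exact: filter_all.
have K x : isSome (sgn2 off bl x) ->
    (2 * content s (binodeat off bl x) + (~~ x.2)%:Z)%R = slot_key off s x.
  case E: (sgn2 off bl x) => [b|] // _.
  by rewrite /content (nodeat_content (P _) (sizeM _) E).
by move=> x y; rewrite !inE => sx sy; rewrite /= !K.
Qed.

(** * The crystal isomorphism on bead counts *)

(* Numbers of A's and of R's in the reduced form of a two-letter word. *)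
Definition pairA (o o' : option bool) : nat :=
  match o, o' with
  | Some false, Some true => 0
  | _, _ => (o == Some true) + (o' == Some true)
  end.
Definition pairR (o o' : option bool) : nat :=
  match o, o' with
  | Some false, Some true => 0
  | _, _ => (o == Some false) + (o' == Some false)
  end.

Lemma word_pair (T : eqType) (f : T -> option bool) x y :
  [/\ numA (word f [:: x; y]) = pairA (f x) (f y),
      numR (word f [:: x; y]) = pairR (f x) (f y) &
      0 < pairA (f x) (f y) ->
      good_addable (word f [:: x; y]) = Some (if f y == Some true then y else x)].
Proof. by rewrite /word /=; case: (f x) => [[]|]; case: (f y) => [[]|]. Qed.

(* U y is the minimum of D z over z >= y, once this holds for large y. *)
Definition future_min (D U : nat -> nat) := forall y, U y = minn (D y) (U y.+1).

(** The bead count after moving a bead from [j] to [j + 1], provided that [b] holds. *)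
Definition drop_at (C : nat -> nat) (j : nat) (b : bool) (y : nat) : nat :=
  C y - (b && (y == j.+1)).

Section Local.
Variables (C1 C2 C1' C2' U : nat -> nat) (j : nat).
Hypotheses (st1 : steps C1) (st2 : steps C2) (le12 : forall y, C1 y <= C2 y).
Hypothesis UE : future_min (fun y => C2 y - C1 y) U.
Hypotheses (E1 : forall y, C1' y + U y = C2 y) (E2 : forall y, C2' y = C1 y + U y).

(** U can increase only where C2 - C1 does, at a bead of C2 facing a gap of C1. The transfer takes
    exactly these beads away from C2 and adds them to C1. *)
Let bead1 y : bead C1' y = bead C2 y && ~~ bead U y.
Proof.
move: (st1 y) (st2 y) (le12 y) (le12 y.+1) (UE y) (UE y.+1) (E1 y) (E1 y.+1).
by rewrite /bead; lia.
Qed.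

Let bead2 y : bead C2' y = bead C1 y || bead U y.
Proof.
move: (st1 y) (st2 y) (le12 y) (le12 y.+1) (UE y) (UE y.+1); rewrite /bead !E2.
by lia.
Qed.

(** Only six bits matter, the beads of C1, C2 and U at [j] and [j + 1]; the recursion for U excludes
    the impossible patterns and the rest is a finite table. Arguments stand in reading order:
    component 2 first before the transfer, component 1 first after it. *)
Lemma transfer_pair :
  pairA (sgn C2 j) (sgn C1 j) = pairA (sgn C1' j) (sgn C2' j) /\
  pairR (sgn C2 j) (sgn C1 j) = pairR (sgn C1' j) (sgn C2' j).
Proof.
rewrite /sgn !bead1 !bead2.
move: (st1 j) (st1 j.+1) (st2 j) (st2 j.+1) (le12 j) (le12 j.+1) (le12 j.+2).
move: (UE j) (UE j.+1) (UE j.+2).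
case A1: (bead C1 j); case A2: (bead C1 j.+1); case B1: (bead C2 j);
case B2: (bead C2 j.+1); case U1: (bead U j); case U2: (bead U j.+1) => //=;
move: A1 A2 B1 B2 U1 U2; rewrite /bead; lia.
Qed.

(** [c] and [c'] are the components holding the rightmost A of the block before and after the
    transfer; they need not agree. The discrepancy is absorbed by changing U at [j + 1] only. *)
Lemma transfer_update :
  0 < pairA (sgn C2 j) (sgn C1 j) ->
  let c := sgn C1 j != Some true in
  let c' := sgn C2' j == Some true in
  let D1 := drop_at C1 j (~~ c) in let D2 := drop_at C2 j c in
  let D1' := drop_at C1' j (~~ c') in let D2' := drop_at C2' j c' in
  [/\ sgn (if c then C2 else C1) j = Some true,
      sgn (if c' then C2' else C1') j = Some true,
      forall y, D1 y <= D2 y &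
   exists V, [/\ future_min (fun y => D2 y - D1 y) V,
     forall y, D1' y + V y = D2 y & forall y, D2' y = D1 y + V y]].
Proof.
move=> pos c c' D1 D2 D1' D2'.
(* Forced by D1' + V = D2 at [j + 1]. *)
pose V y := if y == j.+1 then U y + ~~ c' - c else U y.
have beadE (C : nat -> nat) y : C y <= C y.+1 <= (C y).+1 -> C y.+1 = C y + bead C y.
  by rewrite /bead; lia.
have stU : steps U.
  by move=> y; move: (st1 y) (st2 y) (le12 y) (le12 y.+1) (UE y) (UE y.+1); lia.
have key : [/\ sgn (if c then C2 else C1) j == Some true,
  sgn (if c' then C2' else C1') j == Some true,
  D1 j.+1 <= D2 j.+1,
  V j.+1 = minn (D2 j.+1 - D1 j.+1) (U j.+2) /\ U j = minn (C2 j - C1 j) (V j.+1) &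
  D1' j.+1 + V j.+1 = D2 j.+1 /\ D2' j.+1 = D1 j.+1 + V j.+1].
  {
  rewrite /V /D1 /D2 /D1' /D2' /drop_at eqxx !andbT E2.
  have EC : C1' j.+1 = C2 j.+1 - U j.+1 by rewrite -E1 addnK.
  rewrite {}EC; move: pos; rewrite /c' /c /sgn ?bead1 ?bead2.
  have := subnKC (le12 j); move: (UE j) (UE j.+1) (le12 j.+1) (le12 j.+2) (UE j.+2).
  move: (beadE C1 _ (st1 j)) (beadE C1 _ (st1 j.+1)).
  move: (beadE C2 _ (st2 j)) (beadE C2 _ (st2 j.+1)).
  move: (beadE U _ (stU j)) (beadE U _ (stU j.+1)).
  case A1: (bead C1 j); case A2: (bead C1 j.+1); case B1: (bead C2 j);
  case B2: (bead C2 j.+1); case U1: (bead U j); case U2: (bead U j.+1) => //=;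
  rewrite ?bead1 ?bead2 ?A1 ?A2 ?B1 ?B2 ?U1 ?U2 //=.
  all: move: (C1 j) (C1 j.+1) (C1 j.+2) (C2 j) (C2 j.+1) (C2 j.+2).
  all: move: (U j) (U j.+1) (U j.+2) (U j.+3); clear.
  all: move=> u u1 u2 u3 a a1 a2 b b1 b2 -> -> -> -> -> ->; move: (b - a) => x + + + + + E.
  all: rewrite -{}E; try lia.
  all: move=> *; split=> //; try split; lia.
  }
have [/eqP s1 /eqP s2 k1 [k2 k3] [k4 k5]] := key.
have other (C : nat -> nat) (b : bool) y : y != j.+1 -> drop_at C j b y = C y.
  by rewrite /drop_at => /negPf ->; rewrite andbF subn0.
have Vo y : y != j.+1 -> V y = U y by rewrite /V => /negPf ->.
split=> // [y|].
  have [->|ny] := eqVneq y j.+1; first exact: k1.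
  by rewrite /D1 /D2 !other.
exists V; split=> y; have [->|ny] := eqVneq y j.+1.
- by rewrite [V j.+2]Vo //; lia.
- have [Ey|nj] := eqVneq y j; first by rewrite Ey [V j]Vo /D1 /D2 ?other //; lia.
  by rewrite !Vo /D1 /D2 ?other //; lia.
- exact: k4.
- by rewrite Vo // /D1' /D2 !other.
- exact: k5.
- by rewrite Vo // /D1 /D2' !other.
Qed.

End Local.

Definition move1 (M : nat) (la : seq nat) (j : nat) :=
  add_node la (nodeat M (cnt M la) j).

Definition move2 (off : bool -> nat) (bl : bipartition) (x : nat * bool) :=
  upd_component bl x.2 (move1 (off x.2) (component bl x.2) x.1).

Lemma ftilde1E M N d i la : is_partition la -> sumn la < M -> M.*2 <= N ->
  2 <= d ->
  ftilde1 d i la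
    = omap (move1 M la) (good_addable (word (sgn (cnt M la)) (class M d i N))).
Proof.
move=> P sM MN d2; rewrite /ftilde1 (signature1E i P sM MN d2).
by rewrite good_addable_map; case: good_addable.
Qed.

Definition bipart (n : nat) (bl : bipartition) : Prop :=
  [/\ is_partition bl.1, is_partition bl.2 & rank bl = n].

Lemma bipart_component n bl c : bipart n bl ->
  is_partition (component bl c) /\ sumn (component bl c) <= n.
Proof. by case=> P1 P2 <-; case: c; split=> //=; rewrite /rank; lia. Qed.

Lemma ftilde2E off s d i n bl (S : seq (nat * bool)) :
    bipart n bl -> (forall c, n < off c) ->
    sorted (fun x y => (slot_key off s x < slot_key off s y)%R) S ->
    (forall x, isSome (sgn2 off bl x) -> (x \in S) = slot_res off s d i x) ->
  ftilde2 d s i bl = omap (move2 off bl) (good_addable (word (sgn2 off bl) S)).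
Proof.
move=> B nM sS SP; rewrite /ftilde2 (@signature2E off s d i bl S) //.
  by rewrite good_addable_map; case: good_addable => // -[j c].
move=> c; have [P le_n] := bipart_component c B; split=> //.
exact: leq_ltn_trans le_n (nM c).
Qed.

Lemma move2P off n bl x : bipart n bl -> (forall c, n < off c) ->
  sgn2 off bl x = Some true ->
  bipart n.+1 (move2 off bl x) /\
  forall c y, cnt (off c) (component (move2 off bl x) c) y
    = drop_at (cnt (off c) (component bl c)) x.1 (x.2 == c) y.
Proof.
move=> B nM sx; case: x sx => j c sx.
have [P le_n] := bipart_component c B.
have [P' S' C'] := add_nodeP P (leq_ltn_trans le_n (nM c)) sx.
case: B => P1 P2 R; split.
  by case: c {sx} P le_n P' S' C' => /= P le_n P' S' _; split=> //;
    rewrite -R /rank /= S'; lia.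
move=> c' y; rewrite /drop_at; case: eqP => [<-|ne] /=.
  by case: c {sx P le_n P' S'} C' => /= C'; exact: C'.
by rewrite subn0; case: c ne {sx P le_n P' S' C'}; case: c'.
Qed.

Definition pair_slots (b : bool) (js : seq nat) : seq (nat * bool) :=
  flatten [seq [:: (j, b); (j, ~~ b)] | j <- js].

Lemma mem_pair_slots b js x : (x \in pair_slots b js) = (x.1 \in js).
Proof.
apply/flatten_mapP/idP; first by case=> j jjs; rewrite !inE => /orP [] /eqP ->.
move=> xs; exists x.1 => //; rewrite !inE; case: x {xs} => j c /=.
by rewrite !xpair_eqE eqxx; case: b; case: c.
Qed.

Lemma res_step M d i j j' : res M d i j -> res M d i j' -> j < j' -> j + d <= j'.
Proof.
rewrite /res => /eqP <-; rewrite eqz_mod_dvd => H jj'.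
have : (d %| j' - j)%N.
  have -> : (j' - j)%N = `|(j'.+1%:Z - M%:Z - (j.+1%:Z - M%:Z))%R|%N by lia.
  exact: H.
by move/dvdn_leq; lia.
Qed.

Lemma sorted_pair_slots (K : nat * bool -> int) b M d i N :
    (forall j, (K (j, b) < K (j, ~~ b))%R) ->
    (forall j j', j + d <= j' -> (K (j, ~~ b) < K (j', b))%R) ->
  sorted (fun x y => (K x < K y)%R) (pair_slots b (class M d i N)).
Proof.
move=> H1 H2; have : sorted (fun j j' => j + d <= j') (class M d i N).
  apply: (@sub_in_sorted _ (mem (class M d i N)) ltn).
  - move=> j j'; rewrite !mem_class => /andP [_ R] /andP [_ R']; exact: res_step R R'.
  - by apply/allP.
  - exact: class_sorted.
elim: (class M d i N) => //= j js IH H; rewrite H1 /=.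
by case: js H IH => //= j' js /andP [jj' H] IH; rewrite H2 //= IH.
Qed.

Definition charge (t : nat) : int * int := (0, t%:Z)%R.

(** The [t] extra beads of component 2 give equal positions equal contents in charge (0, t). *)
Definition offs (M t : nat) (c : bool) := if c then M + t else M.

(* Charge (0, t): on each diagonal component 2 is read before component 1. *)
Lemma ftilde2_charge M t N d i n bl : bipart n bl -> n < M ->
  (M + t).*2 <= N -> 2 <= d ->
  ftilde2 d (charge t) i bl = omap (move2 (offs M t) bl)
    (good_addable (word (sgn2 (offs M t) bl) (pair_slots true (class M d i N)))).
Proof.
move=> B nM MN d2; apply: (ftilde2E B).
- by case => /=; lia.
- by apply: sorted_pair_slots => [j|j j']; rewrite /slot_key /=; lia.
move=> [j c]; rewrite mem_pair_slots /sgn2 /= => H.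
have [P le_n] := bipart_component c B.
have jN : j < N.
  case E: (sgn _ j) H => [b|] // _; apply: (sgn_lt P _ _ E).
    by case: (c) le_n => /=; lia.
  by case: (c) => /=; lia.
rewrite mem_class jN /slot_res /res /offs; 
  case: c {P le_n H}; congr (_ == _ %[mod _])%Z => /=; lia.
Qed.

(* Charge (0, t + d), with positions in component 2 still measured from M + t:
   component 1 is read before component 2. *)
Lemma ftilde2_shifted M t N d i n bl : bipart n bl -> n < M ->
  (M + t).*2 <= N -> 2 <= d ->
  ftilde2 d (charge (t + d)) i bl = omap (move2 (offs M t) bl)
    (good_addable (word (sgn2 (offs M t) bl) (pair_slots false (class M d i N)))).
Proof.
move=> B nM MN d2; apply: (ftilde2E B).
- by case => /=; lia.
(* Component 2 is now shifted by exactly [d]: its letter at [j] ties in content with component 1 at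
   [j + d], which it precedes, so it still belongs to the block of [j]. *)
- by apply: sorted_pair_slots => [j|j j']; rewrite /slot_key /=; lia.
move=> [j c]; rewrite mem_pair_slots /sgn2 /= => H.
have [P le_n] := bipart_component c B.
have jN : j < N.
  case E: (sgn _ j) H => [b|] // _; apply: (sgn_lt P _ _ E).
    by case: (c) le_n => /=; lia.
  by case: (c) => /=; lia.
rewrite mem_class jN /slot_res /res /offs; case: c {P le_n H} => /=; last first.
  by congr (_ == _ %[mod _])%Z; lia.
have -> : (j.+1%:Z - (M + t)%N%:Z + (t + d)%N%:Z = j.+1%:Z - M%:Z + d%:Z)%R by lia.
by rewrite modzDr.
Qed.

(* [bl] in charge (0, t) is sent to [bl'] in charge (0, t + d); positions in
   component 2 are measured from M + t on both sides, which hides d.  U y is the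
   number of beads below y in component 2 that the injection of the Psi maps
   misses. *)
Definition transfer (M t : nat) (bl bl' : bipartition) : Prop :=
  (forall y, cnt M bl.1 y <= cnt (M + t) bl.2 y) /\
  exists U, [/\ future_min (fun y => cnt (M + t) bl.2 y - cnt M bl.1 y) U,
    forall y, cnt M bl'.1 y + U y = cnt (M + t) bl.2 y
  & forall y, cnt (M + t) bl'.2 y = cnt M bl.1 y + U y].

(** Both signatures are cut into the blocks of the diagonals of the class. As the blocks agree in
    reduced form, the two good nodes lie on the same diagonal, and [transfer_update] treats that
    diagonal. *)
Lemma transfer_ftilde2 M t d i n bl bl' b1 :
    bipart n bl -> bipart n bl' -> n.+1 < M -> 2 <= d -> transfer M t bl bl' ->
    ftilde2 d (charge t) i bl = Some b1 ->
  exists b1', [/\ ftilde2 d (charge (t + d)) i bl' = Some b1',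
    bipart n.+1 b1, bipart n.+1 b1' & transfer M t b1 b1'].
Proof.
move=> B B' nM d2 [le12 [U [UE E1 E2]]]; have nM' := ltnW nM.
have nO c : n < offs M t c by case: c => /=; lia.
have st c : steps (cnt (offs M t c) (component bl c)).
  have [P S] := bipart_component c B; apply: cnt_steps => //.
  by have := size_le_sumn P; have := nO c; lia.
have st1 : steps (cnt M bl.1) := st false.
have st2 : steps (cnt (M + t) bl.2) := st true.
have H j := transfer_pair j st1 st2 le12 UE E1 E2.
have J j := transfer_update (j := j) st1 st2 le12 UE E1 E2.
rewrite (ftilde2_charge i B nM' (leqnn _) d2) (ftilde2_shifted i B' nM' (leqnn _) d2).
rewrite !word_flatten -!map_comp.
have [j|_ _] := @good_addable_blocks _ _ _
  (fun j => word (sgn2 (offs M t) bl) [:: (j, true); (j, false)])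
  (fun j => word (sgn2 (offs M t) bl') [:: (j, false); (j, true)])
  (class M d i (M + t).*2).
  have [-> -> _] := word_pair (sgn2 (offs M t) bl) (j, true) (j, false).
  have [-> -> _] := word_pair (sgn2 (offs M t) bl') (j, false) (j, true).
  by move=> _; exact: H.
move=> [-> //|[j [jS -> ->]]].
have [-> _ G] := word_pair (sgn2 (offs M t) bl) (j, true) (j, false).
have [_ _ G'] := word_pair (sgn2 (offs M t) bl') (j, false) (j, true).
move=> pos; rewrite G // G'; last by have [<- _] := H j.
have {H J} := J j pos; rewrite {1 2}/sgn2 /=.
set c := sgn (cnt M bl.1) j != Some true.
set c' := sgn (cnt (M + t) bl'.2) j == Some true.
move=> [s1 s2 le [V [VE F1 F2]]].
have -> : (if sgn (cnt M bl.1) j == Some true then (j, false) else (j, true)) = (j, c).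
  by rewrite /c; case: eqP.
have -> : (if sgn (cnt (M + t) bl'.2) j == Some true then (j, true) else (j, false)) = (j, c').
  by rewrite /c'; case: eqP.
have {}s1 : sgn2 (offs M t) bl (j, c) = Some true by rewrite /sgn2 /=; case: (c) s1.
have {}s2 : sgn2 (offs M t) bl' (j, c') = Some true by rewrite /sgn2 /=; case: (c') s2.
have [Bn Cn] := move2P B nO s1; have [Bn' Cn'] := move2P B' nO s2.
move=> [<-]; exists (move2 (offs M t) bl' (j, c')); split=> //.
have {Cn} [Cf Ct] := (Cn false, Cn true); have {Cn'} [Cf' Ct'] := (Cn' false, Cn' true).
rewrite /= !(eqbF_neg, eqb_id) in Cf Ct Cf' Ct'.
split=> [y|]; first by rewrite Cf Ct; exact: le.
exists V; split=> y; rewrite ?Cf ?Ct ?Cf' ?Ct'; [exact: VE | exact: F1 | exact: F2].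
Qed.

Lemma cnt_nil M y : cnt M [::] y = minn y M.
Proof. by apply: cntP => // [|a]; rewrite ?nth_nil; lia. Qed.

Lemma transfer_nil M t : transfer M t ([::], [::]) ([::], [::]).
Proof.
split=> [y|]; first by rewrite /= !cnt_nil; lia.
(* This difference is nondecreasing, hence its own future minimum. *)
exists (fun y => minn y (M + t) - minn y M).
by split=> y; rewrite /= !cnt_nil; lia.
Qed.

Lemma transfer_fword2 M t d w bl : size w < M -> 2 <= d ->
    fword2 d (charge t) w = Some bl ->
  exists bl', [/\ fword2 d (charge (t + d)) w = Some bl',
    bipart (size w) bl, bipart (size w) bl' & transfer M t bl bl'].
Proof.
move=> + d2; elim: w bl => [|i w IH] bl /= wM.
  by move=> [<-]; exists ([::], [::]); split=> //; exact: transfer_nil.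
case E: (fword2 _ _ w) => [b|] //= Eb.
have [b' [-> B B' T]] := IH b (ltnW wM) E.
exact: transfer_ftilde2 B B' wM d2 T Eb.
Qed.

(** * The maps Psi *)

Definition below (X : seq nat) (y : nat) := count (fun x => x < y) X.

Lemma belowS X y : uniq X -> below X y.+1 = below X y + (y \in X).
Proof.
move=> uX; rewrite /below -(count_uniq_mem y uX).
elim: X {uX} => //= x X ->; case: (ltngtP x y) => /=; lia.
Qed.

Lemma below_steps X : uniq X -> steps (below X).
Proof. by move=> uX y; rewrite belowS //; case: (_ \in _); lia. Qed.

Lemma below_mem X y : uniq X -> (y \in X) = bead (below X) y.
Proof. by move=> uX; rewrite /bead belowS //; case: (_ \in _); lia. Qed.

Lemma below0 X : below X 0 = 0.
Proof. by rewrite /below; elim: X. Qed.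

Lemma below_beads X C : steps C -> C 0 = 0 -> uniq X -> X =i bead C ->
  below X =1 C.
Proof.
move=> st C0 uX E; elim=> [|y IH]; first by rewrite below0.
by rewrite belowS // IH E -topredE /= /bead; have := st y; lia.
Qed.

Lemma below_rem b X y : b \in X -> below X y = (b < y) + below (rem b X) y.
Proof.
by move=> bX; rewrite /below (permP (perm_to_rem bX)).
Qed.

Lemma ltn_sorted_uniq X : sorted ltn X -> uniq X.
Proof. by rewrite ltn_sorted_uniq_leq => /andP []. Qed.

Lemma last_sorted x0 (s : seq nat) : sorted ltn s -> s != [::] ->
  last x0 s \in s /\ forall x, x \in s -> x <= last x0 s.
Proof.
case: s => // x s /= xs _; split; first exact: mem_last.
elim: s x xs {x0} => [|y s IH] x /=; first by move=> _ z; rewrite inE => /eqP ->.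
move=> /andP [xy ys] z; rewrite inE => /predU1P [->|]; last exact: IH.
by apply: leq_trans (ltnW xy) (IH y ys y (mem_head _ _)).
Qed.

Lemma phi_pickP X a : sorted ltn X -> 0 < below X a.+1 ->
  let b := phi_pick X a in
  [/\ b \in X, b <= a & forall y, b < y <= a.+1 -> below X y = below X a.+1].
Proof.
move=> sX; rewrite -has_count => /hasP [x xX xa] b.
have [||bF bmax] := @last_sorted (last 0 X) [seq b <- X | b <= a].
- by apply: sorted_filter => //; exact: ltn_trans.
- apply/eqP => E; have : x \in [seq b <- X | b <= a] by rewrite mem_filter -ltnS xa.
  by rewrite E.
move: bF bmax; rewrite -/(phi_pick X a) -/b mem_filter => /andP [ba bX] bmax.
split=> // y /andP [yb ya]; apply/eq_in_count => z zX; apply/idP/idP => /= H.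
  exact: leq_trans ya.
by apply: leq_ltn_trans yb; apply: bmax; rewrite mem_filter zX andbT.
Qed.

(* Since X1 is dominated by X2, the second clause of the choice never applies. *)
Lemma below_phi_values X1 X2 U N :
    sorted ltn X1 -> sorted ltn X2 -> (forall y, below X1 y <= below X2 y) ->
    future_min (fun y => below X2 y - below X1 y) U ->
    (forall y, N <= y -> U y = below X2 y - below X1 y) ->
  let Y := phi_values X1 X2 in
  [/\ uniq Y, {subset Y <= X2} & forall y, below Y y + U y = below X2 y].
Proof.
elim: X1 X2 => [|a X1 IH] X2 /= s1 s2 le12 UE UN.
  have st := below_steps (ltn_sorted_uniq s2).
  suff H k y : N <= y + k -> U y = below X2 y.
    by split=> // y; rewrite (H N y) // leq_addl.
  elim: k y => [|k IH] y Ny; first by rewrite UN ?subn0 // -[y]addn0.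
  by rewrite UE IH; [have := st y; rewrite subn0; lia | rewrite addSnnS].
have u1 : uniq (a :: X1) by exact: ltn_sorted_uniq.
have u2 := ltn_sorted_uniq s2; have st2 := below_steps u2.
have min1 y : y <= a.+1 -> below X1 y = 0.
  move=> ya; apply/eqP; rewrite -leqn0 leqNgt -has_count; apply/negP => /hasP [x xX xy].
  have := order_path_min ltn_trans s1; move=> /allP /(_ x xX) /= ax.
  by have := leq_trans xy ya; rewrite ltnS leqNgt ax.
have pos : 0 < below X2 a.+1 by have := le12 a.+1; lia.
have [] := phi_pickP s2 pos; set b := phi_pick X2 a => bX ba const.
have c2 y := below_rem y bX.
have Umono y z : y <= z -> U y <= U z.
  by move=> /subnK <-; elim: (z - y) => // k IHk; have := UE (k + y); rewrite addSn; lia.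
have Ua := UE a.+1.
(* Removing [a] from the first set and its partner [b] from the second lowers the difference by one
   exactly on b < y <= a. There U lies strictly below the old difference, so it remains the future
   minimum of the new one. *)
have D' y : b < y <= a -> U y < below X2 y.
  move=> /andP [yb ya]; have := Umono y a.+1 (leqW ya); have := const y.
  have := min1 a.+1 (leqnn _); lia.
have [||y|y|y Ny|uY sY cY] := IH (rem b X2).
- exact: path_sorted s1.
- by rewrite rem_filter //; exact: sorted_filter ltn_trans _ _ s2.
- have := c2 y; have := le12 y; have := min1 y; have := const y; lia.
- have := c2 y; have := le12 y; have := min1 y; have := const y.
  have := D' y; have := UE y; lia.
- have := c2 y; have := le12 y; have := D' y; have := UN y Ny; have := min1 y; lia.
split=> [|x|y].
- by rewrite /= uY andbT; apply/negP => /sY; rewrite mem_rem_uniqF.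
- by rewrite inE => /predU1P [->//|/sY /mem_rem].
by rewrite c2 -cY /= -addnA.
Qed.

Definition beta (M : nat) (la : seq nat) : seq nat :=
  [seq y <- iota 0 (M + sumn la) | bead (cnt M la) y].

Lemma cnt_top M la y : is_partition la -> size la <= M -> M + sumn la <= y ->
  cnt M la y = M.
Proof.
by move=> P sM H; apply: cnt_high => //; have := nth_le_sumn la 0; lia.
Qed.

Lemma mem_beta M la y : is_partition la -> size la <= M ->
  (y \in beta M la) = bead (cnt M la) y.
Proof.
move=> P sM; rewrite mem_filter mem_iota add0n /=.
case: ltnP => H; rewrite ?andbT // andbF /bead !cnt_top ?ltnn //; exact: leqW.
Qed.

Lemma beta_sorted M la : sorted ltn (beta M la).
Proof. exact: sorted_filter ltn_trans _ _ (iota_ltn_sorted _ _). Qed.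

Lemma below_beta M la : is_partition la -> size la <= M ->
  below (beta M la) =1 cnt M la.
Proof.
move=> P sM; apply: below_beads.
- exact: cnt_steps.
- by rewrite cnt_low.
- exact/ltn_sorted_uniq/beta_sorted.
- by move=> y; exact: mem_beta.
Qed.

Lemma size_beta M la : is_partition la -> size la <= M -> size (beta M la) = M.
Proof.
move=> P sM; rewrite -[RHS](cnt_top P sM (leqnn _)) -below_beta //.
rewrite /below -[LHS]count_predT; apply/eq_in_count => y.
by rewrite mem_filter mem_iota add0n => /andP [_ /= ->].
Qed.

Lemma sort_leq_eq (X Y : seq nat) : uniq X -> sorted ltn Y -> X =i Y ->
  sort leq X = Y.
Proof.
move=> uX sY E; apply: (irr_sorted_eq ltn_trans ltnn) => //.
  by rewrite ltn_sorted_uniq_leq sort_uniq uX (sort_sorted leq_total).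
by move=> y; rewrite mem_sort E.
Qed.

(** The recursion [future_min] alone does not determine U, as the zero function also satisfies it.
    The missing boundary value comes from above all beads, where every count is constant. *)
Lemma transfer_future_min_top M t n bl bl' U : bipart n bl -> bipart n bl' ->
    n < M -> (forall y, cnt M bl'.1 y + U y = cnt (M + t) bl.2 y) ->
  forall y, M + t + n <= y -> U y = cnt (M + t) bl.2 y - cnt M bl.1 y.
Proof.
move=> [P1 P2 R] [P1' P2' R'] nM E y ny; rewrite /rank in R R'.
have := size_le_sumn P1; have := size_le_sumn P2.
have := size_le_sumn P1'; have := size_le_sumn P2' => *; have := E y.
by rewrite !cnt_top //; lia.
Qed.

(** The image of the injection has the counts C2 - U, those of the new component 1. The missed beads
    join X1, and the shift by [d] with the filling 0, ..., d - 1 only renormalises to M + t + d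
    beads. *)
Lemma Psi_transfer M t d n bl bl' : bipart n bl -> bipart n bl' -> n < M ->
    transfer M t bl bl' ->
  Psi d (beta M bl.1, beta (M + t) bl.2)
    = (beta M bl'.1, beta (M + t + d) bl'.2).
Proof.
move=> B B' nM [le12 [U [UE E1 E2]]].
have UT := transfer_future_min_top B B' nM E1.
case: (B) => P1 P2 R; case: (B') => P1' P2' R'; rewrite /rank in R R'.
have := size_le_sumn P1; have := size_le_sumn P2.
have := size_le_sumn P1'; have := size_le_sumn P2' => z2' z1' z2 z1.
have [s1 s2 s1' s2'] : [/\ size bl.1 <= M, size bl.2 <= M + t,
    size bl'.1 <= M & size bl'.2 <= M + t].
  by split; lia.
have [||y|y|y|uY sY cY] := @below_phi_values (beta M bl.1) (beta (M + t) bl.2) U (M + t + n).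
- exact: beta_sorted.
- exact: beta_sorted.
- by rewrite !below_beta.
- by rewrite !below_beta.
- by rewrite !below_beta //; exact: UT.
have {}cY y : below (phi_values (beta M bl.1) (beta (M + t) bl.2)) y = cnt M bl'.1 y.
  by have := cY y; rewrite below_beta // -E1 => /addIn.
have mY y : (y \in phi_values (beta M bl.1) (beta (M + t) bl.2)) = bead (cnt M bl'.1) y.
  by rewrite below_mem // /bead !cY.
rewrite /Psi /=; congr (_, _).
  by apply: sort_leq_eq => // [|y]; [exact: beta_sorted | rewrite mY mem_beta].
have st1 := cnt_steps P1 s1; have st2 := cnt_steps P2 s2.
apply: sort_leq_eq => // [||y]; [exact: undup_uniq | exact: beta_sorted |].
rewrite mem_undup mem_beta //; last by rewrite ltnW // ltn_addr //; lia.
rewrite !mem_cat mem_iota add0n /=.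
have [yd|yd] := ltnP y d.
  rewrite !orbT; symmetry; rewrite /bead.
  by rewrite ![cnt (M + t + d) _ _]cnt_low; lia.
rewrite orbF -(subnK yd); set z := y - d; have addI : injective (addn^~ d) by move=> ? ? /addIn.
rewrite !(mem_map addI) mem_beta // mem_filter mY mem_beta // /bead -addSn !cnt_shift //.
rewrite ltn_add2r !E2; have := st1 z; have := st2 z; have := E1 z; have := E1 z.+1.
have := UE z; have := cnt_steps P1' s1' z; have := le12 z; have := le12 z.+1; lia.
Qed.

(** * Consequences of (C) *)

Lemma future_min_uniq D U V N : future_min D U -> future_min D V ->
  (forall y, N <= y -> U y = V y) -> U =1 V.
Proof.
move=> UE VE H y; suff K k z : N <= z + k -> U z = V z by apply: (K N); exact: leq_addl.
elim: k z => [|k IH] z; first by rewrite addn0; exact: H.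
by move=> Nz; rewrite UE VE IH // addSnnS.
Qed.

(** This is what lets a step of the e-chain be identified with a step of the 2e-chain that starts
    from the same bipartition in the same charge. *)
Lemma transfer_functional M t n bl b1 b2 :
    bipart n bl -> bipart n b1 -> bipart n b2 -> n < M ->
  transfer M t bl b1 -> transfer M t bl b2 -> b1 = b2.
Proof.
move=> B B1 B2 nM [_ [U [UE E1 E2]]] [_ [V [VE F1 F2]]].
have UV : U =1 V.
  apply: (future_min_uniq UE VE (N := M + t + n)) => y Ny.
  by rewrite (transfer_future_min_top B B1 nM E1 Ny) (transfer_future_min_top B B2 nM F1 Ny).
case: B1 B2 => P1 Q1 R1 [P2 Q2 R2]; rewrite /rank in R1 R2.
have := size_le_sumn P1; have := size_le_sumn Q1.
have := size_le_sumn P2; have := size_le_sumn Q2 => z4 z3 z2 z1.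
rewrite [b1]surjective_pairing [b2]surjective_pairing; congr (_, _).
  by apply: (@cnt_inj M) => // [||y]; [lia | lia | have := E1 y; have := F1 y; rewrite UV; lia].
by apply: (@cnt_inj (M + t)) => // [||y]; [lia | lia | rewrite E2 F2 UV].
Qed.

(** If each bead of component 1 is one of component 2, the difference never decreases. It can then
    serve as U, and the transfer fixes [bl]. *)
Lemma transfer_subset M t n bl : bipart n bl -> n < M ->
    {subset beta M bl.1 <= beta (M + t) bl.2} ->
    (forall y, cnt M bl.1 y <= cnt (M + t) bl.2 y) ->
  transfer M t bl bl.
Proof.
move=> B nM sub le12; split=> //.
case: (B) => P1 P2 R; rewrite /rank in R.
have := size_le_sumn P1; have := size_le_sumn P2 => z2 z1.
have s1 : size bl.1 <= M by lia.
have s2 : size bl.2 <= M + t by lia.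
exists (fun y => cnt (M + t) bl.2 y - cnt M bl.1 y); split=> y; try (have := le12 y; lia).
have := sub y; rewrite !mem_beta // /bead.
have := cnt_steps P1 s1 y; have := cnt_steps P2 s2 y; have := le12 y.+1; have := le12 y.
by lia.
Qed.

Lemma fword2_chain M d t w bl : size w < M -> 2 <= d ->
    fword2 d (charge t) w = Some bl ->
  exists f : nat -> bipartition, f 0 = bl /\ forall k,
    [/\ fword2 d (charge (t + k * d)) w = Some (f k), bipart (size w) (f k)
      & transfer M (t + k * d) (f k) (f k.+1)].
Proof.
move=> wM d2 E; pose f k := odflt ([::], [::]) (fword2 d (charge (t + k * d)) w).
have H k : fword2 d (charge (t + k * d)) w = Some (f k).
  rewrite /f; suff : fword2 d (charge (t + k * d)) w by case: fword2.
  elim: k => [|k]; first by rewrite addn0 E.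
  case E' : fword2 => [b|] // _.
  have [b' [+ _ _ _]] := transfer_fword2 wM d2 E'.
  by rewrite mulSnr addnA => ->.
exists f; split; first by rewrite /f addn0 E.
move=> k; have [b' [E' B B' T]] := transfer_fword2 wM d2 (H k); split=> //.
by have := H k.+1; rewrite mulSnr addnA E' => -[<-].
Qed.

(* By (C), every other step of the e-chain is trivial; the remaining ones are
   the steps of the 2e-chain. *)
Lemma fword2_routes (HC : statement_C) e w w' la : 2 <= e ->
    fword2 e (charge 0) w = Some (la, la) ->
    fword2 (2 * e) (charge e) w' = Some (la, la) -> 
  forall k, fword2 e (charge ((2 * k).+1 * e)) w
          = fword2 (2 * e) (charge (e + k * (2 * e))) w'.
Proof.
move=> e2 E E'.
have [M [wM wM']] : exists M, size w < M /\ size w' < M.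
  by exists (size w + size w').+1; lia.
have [f [f0 Hf']] := fword2_chain wM e2 E.
have {Hf'} Hf k : [/\ fword2 e (charge (k * e)) w = Some (f k), bipart (size w) (f k)
      & transfer M (k * e) (f k) (f k.+1)] by have := Hf' k; rewrite add0n.
have e2' : 2 <= 2 * e by lia.
have [g [g0 Hg]] := fword2_chain wM' e2' E'.
have Ew : size w = size w'.
  case: (Hf 0) => _ [_ _ R] _; case: (Hg 0) => _ [_ _ R'] _.
  by rewrite -R -R' f0 g0.
have I k : iter k (Psi e) (beta M la, beta M la) = (beta M (f k).1, beta (M + k * e) (f k).2).
  elim: k => [|k IH]; first by rewrite /= f0 addn0.
  have [_ B T] := Hf k; have [_ B' _] := Hf k.+1.
  by rewrite /= IH (Psi_transfer e B B' wM T) mulSnr addnA.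
have [P sM] : is_partition la /\ size la < M.
  case: (Hf 0) => _ [P _ R] _; move: P R; rewrite f0 /rank /= => P R; split=> //.
  by have := size_le_sumn P; lia.
have S k : {subset beta M (f (2 * k)).1 <= beta (M + (2 * k) * e) (f (2 * k)).2}.
  case: k => [|k]; first by rewrite muln0 f0 addn0.
  (* An even positive number 2k + 2 of steps is the odd parameter 2k + 1 in (C); with no step taken
     the two bead sets coincide. *)
  have := HC e M (2 * k).+1 (beta M la); cbv zeta; rewrite I.
  have -> : 2 * k.+1 = (2 * k).+2 by lia.
  apply; first by lia.
    by rewrite /in_P beta_sorted (size_beta P (ltnW sM)) eqxx.
  by rewrite /= oddM.
have D k : f (2 * k).+1 = f (2 * k).
  have [_ B T] := Hf (2 * k); have [_ B' _] := Hf (2 * k).+1.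
  apply: (transfer_functional B B' B wM T); apply: (transfer_subset B wM (S k)).
  by case: T.
(* The e-chain passes from f (2k + 1) to f (2k + 2) in charge (2k + 1)e = e + 2ke, which is the
   charge of the step from g k; the next e-step is trivial. *)
have G k : g k = f (2 * k).+1.
  elim: k => [|k IH]; first by rewrite D f0 g0.
  have [_ B T] := Hf (2 * k).+1; have [_ B' _] := Hf (2 * k).+2.
  have [_ _ T'] := Hg k; have [_ B'' _] := Hg k.+1.
  have -> : 2 * k.+1 = (2 * k).+2 by lia.
  have D' := D k.+1; have E2 : 2 * k.+1 = (2 * k).+2 by lia.
  rewrite E2 in D'; rewrite D'; rewrite -Ew in B''.
  apply: (transfer_functional B B'' B' wM _ T).
  by rewrite -IH; have -> : (2 * k).+1 * e = e + k * (2 * e) by lia.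
move=> k; have [-> _ _] := Hg k; have [F _ _] := Hf (2 * k).+1.
by rewrite G -F.
Qed.

(** * Regular partitions *)

(* d consecutive beads above a gap are d equal positive parts. *)
Definition bead_regular (d : nat) (C : nat -> nat) : Prop :=
  forall x, C (x + d) = C x + d -> C x = x.

Lemma steps_add C x k : steps C -> C (x + k) <= C x + k.
Proof.
move=> st; elim: k => [|k IH]; first by rewrite !addn0.
by have := st (x + k); rewrite -addnS; lia.
Qed.

Lemma regular_bead_regular d M la : 0 < d -> size la <= M -> regular d la ->
  bead_regular d (cnt M la).
Proof.
move=> d0 sM /andP [P /allP R] x; set C := cnt M la => H.
have st : steps C by exact: cnt_steps.
apply/eqP; rewrite eqn_leq cnt_le_id //= leqNgt; apply/negP => gap.
pose a := M - C (x + d); have CM := cnt_le M la (x + d); rewrite -/C in CM.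
(* Consecutive beads give equal parts, and the part is the number of gaps below them. *)
have part k : k < d -> nth 0 la (a + k) = x - C x.
  move=> kd; have E l : l <= d -> C (x + l) = C x + l.
    move=> ld; have := steps_add x l st; have := steps_add (x + l) (d - l) st.
    by rewrite -addnA subnKC //; lia.
  have := cntG (x + (d - k)) (a + k) P sM; have := cntG (x + (d - k.+1)) (a + k) P sM.
  by rewrite -/C !E; lia.
have sz : a + d <= size la.
  have pd : d.-1 < d by lia.
  by have := partition_gt0 (a + d.-1) P; rewrite (part _ pd); lia.
have : x - C x \in la.
  by rewrite -(part 0 d0) mem_nth // (leq_trans _ sz) // ltn_add2l.
move/R; apply/negP; rewrite -leqNgt.
have szt : size (take d (drop a la)) = d.
  by rewrite size_takel // size_drop; lia.
rewrite -[la in count_mem _ la](cat_take_drop a) -[drop a la](cat_take_drop d) !count_cat.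
have /eqP -> : count_mem (x - C x) (take d (drop a la)) == size (take d (drop a la)).
  rewrite -all_count; apply/(all_nthP 0) => k; rewrite szt => kd.
  by rewrite /= nth_take // nth_drop part.
by rewrite szt addnCA leq_addr.
Qed.

Lemma word_split (T : eqType) (sg : T -> option bool) s w1 b x w2 :
  word sg s = w1 ++ (b, x) :: w2 ->
  exists s1 s2, [/\ s = s1 ++ x :: s2, w1 = word sg s1 & w2 = word sg s2].
Proof.
elim: s w1 => [|y s IH] w1 /=; first by case: w1.
case E: (sg y) => [c|] /=; last first.
  move=> /IH [s1 [s2 [-> -> ->]]]; exists (y :: s1), s2; split=> //.
  by rewrite /word /= E.
case: w1 => [[_ -> <-]|l w1 [<- /IH [s1 [s2 [-> -> ->]]]]]; first by exists [::], s.
by exists (y :: s1), s2; split; rewrite // /word /= E.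
Qed.

Lemma class_cat M d i N s1 x s2 : class M d i N = s1 ++ x :: s2 ->
  s1 = class M d i x.
Proof.
move=> E; have S : sorted ltn (s1 ++ x :: s2) by rewrite -E class_sorted.
have /andP [A _] : allrel ltn s1 (x :: s2) && true.
  by move: S; rewrite (sorted_pairwise ltn_trans) pairwise_cat => /and3P [->].
have /allP B : all (ltn x) s2.
  move: S; rewrite (sorted_pairwise ltn_trans) pairwise_cat => /and3P [_ _] /=.
  by case/andP.
apply: (irr_sorted_eq ltn_trans ltnn); first 2 last.
- move=> y; rewrite mem_class; have Ey : (y \in s1 ++ x :: s2) = (y < N) && res M d i y.
    by rewrite -E mem_class.
  have xN : x < N.
    have : x \in class M d i N by rewrite E mem_cat mem_head orbT.
    by rewrite mem_class => /andP [].
  apply/idP/andP => [ys|[yx R]].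
    have := allrelP A y x ys (mem_head _ _) => /= yx; split=> //.
    by move: Ey; rewrite mem_cat ys => /esym/andP [].
  move: Ey; rewrite R (ltn_trans yx xN) mem_cat inE => /or3P [//|/eqP ey|/B /= xy].
    by rewrite ey ltnn in yx.
  by have := ltn_trans yx xy; rewrite ltnn.
- by move: S; rewrite !(sorted_pairwise ltn_trans) pairwise_cat => /and3P [].
- exact: class_sorted.
Qed.

Lemma class_split M d i N x : x < N -> res M d i x ->
  exists s, class M d i N = class M d i x ++ x :: s.
Proof.
move=> xN R; exists [seq y <- iota x.+1 (N - x.+1) | res M d i y].
have EN : N = x + (N - x.+1).+1 by lia.
by rewrite /class {1}EN iotaD filter_cat add0n /= R.
Qed.

Lemma class_apart M d i N x y : 2 <= d -> x \in class M d i N ->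
  y \in class M d i N -> x != y -> (x.+2 <= y) || (y.+2 <= x).
Proof.
rewrite !mem_class => d2 /andP [_ Rx] /andP [_ Ry]; rewrite neq_ltn => /orP [] H.
  by rewrite (res_gap d2 Rx Ry H).
by rewrite (res_gap d2 Ry Rx H) orbT.
Qed.

(** Going up from the gap [y], the first bead met has a gap just before it. *)
Lemma gap_before_bead C y z : ~~ bead C y -> bead C z -> y < z ->
  exists2 x, sgn C x = Some false & y <= x.
Proof.
move=> ny bz /subnKC; move: (z - y.+1) => k E; elim: k y ny E => [|k IH] y ny E.
  by exists y => //; rewrite /sgn -E addn0 in bz *; rewrite bz (negPf ny).
case b: (bead C y.+1); first by exists y; rewrite // /sgn b (negPf ny).
have [|x sx yx] := IH y.+1 (negbT b); first by lia.
by exists x => //; exact: ltnW.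
Qed.

(** The residue is that of the last removable node, whose R is shown to survive. The node removed is
    the good removable node of this residue, which may be a different one. *)
Lemma regular_predecessor d M la : 2 <= d -> is_partition la -> sumn la < M ->
    bead_regular d (cnt M la) -> la != [::] ->
  exists i la', [/\ is_partition la', sumn la = (sumn la').+1,
    bead_regular d (cnt M la') & ftilde1 d i la' = Some la].
Proof.
move=> d2 P sM; set C := cnt M la => reg la_n0.
have sizeM : size la < M by exact: leq_ltn_trans (size_le_sumn P) sM.
have st : steps C := cnt_steps P (ltnW sizeM).
have Cid y : C y <= y := cnt_le_id y P (ltnW sizeM).
have lt_top j b : sgn C j = Some b -> j < M.*2 := sgn_lt P sM (leqnn _).
have exR : exists j, sgn C j == Some false.
  have [b R] : exists b, removable la ((size la).-1, b).
    exists (nth 0 la (size la).-1).-1; rewrite removableE //.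
    have sz : 0 < size la by case: (la) la_n0.
    have := partition_gt0 (size la).-1 P; have := partition_gt0 (size la).-1.+1 P.
    by lia.
  have : (false, ((size la).-1, b)) \in letters (addable_nodes la) (removable_nodes la).
    by rewrite mem_letters removable_nodesE.
  by move=> /(letter_nodesP P sizeM) [j sj _]; exists j; apply/eqP.
have ubR j : sgn C j == Some false -> j <= M.*2 by move=> /eqP /lt_top /ltnW.
have [j /eqP sj jmax] := ex_maxnP exR ubR.
pose i : int := (j.+1%:Z - M%:Z)%R; have Rj : res M d i j by rewrite /res eqxx.
have jN := lt_top _ _ sj.
have pos : 0 < numR (word (sgn C) (class M d i M.*2)).
  have [s Es] := class_split jN Rj; rewrite Es word_cat -cat1s word_cat.
  have -> : word (sgn C) s = [::].
    case Ew: (word (sgn C) s) => [|[b y] w] //.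
    have : (b, y) \in word (sgn C) s by rewrite Ew mem_head.
    rewrite mem_word => /andP [ys /eqP sy].
    have yc : y \in class M d i M.*2 by rewrite Es mem_cat inE ys !orbT.
    have jy : j < y.
      have := class_sorted M d i M.*2; rewrite Es (sorted_pairwise ltn_trans).
      by rewrite pairwise_cat => /and3P [_ _] /= /andP [/allP /(_ y ys)].
    move: yc; rewrite mem_class => /andP [_ Ry].
    have jdy := res_step Rj Ry jy.
    case: b sy {Ew} => sy; last by have := jmax y; rewrite sy eqxx => /(_ isT); lia.
    (* A gap here would yield a removable node after the last one. So an A at [y], at least [d]
       further on, needs a run of [d] beads above the gap at [j], against regularity. *)
    have beads z : j < z <= y -> bead C z.
      move=> /andP [jz zy]; apply/negPn/negP => nz.
      have by_ : bead C y by move/(sgnP _ _ st): sy; rewrite /bead; lia.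
      have [x sx zx] : exists2 x, sgn C x = Some false & z <= x.
        apply: (gap_before_bead nz by_); rewrite ltn_neqAle zy andbT.
        by apply: contraNneq nz => ->.
      by have := jmax x; rewrite sx eqxx => /(_ isT); lia.
    have run l : l <= d -> C (j.+1 + l) = C j.+1 + l.
      elim: l => [|l IH] ld; first by rewrite !addn0.
      have := beads (j.+1 + l); have := IH (ltnW ld); have := st (j.+1 + l).
      by rewrite /bead addnS; lia.
    have := reg j.+1 (run d (leqnn d)); move/(sgnP _ _ st): sj => [-> _].
    by have := Cid j; lia.
  rewrite numR_cat cats0 /word /= sj /=; set a := numR _ - _.
  by rewrite /numR /=; lia.
have [w1 [x [w2 [Ew R0 A0]]]] := good_removable_split pos.
have [s1 [s2 [Es Ew1 Ew2]]] := word_split Ew.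
have Es1 := class_cat Es.
have xc : x \in class M d i M.*2 by rewrite Es mem_cat mem_head orbT.
have sx : sgn C x = Some false.
  have : (false, x) \in word (sgn C) (class M d i M.*2).
    by rewrite Ew mem_cat mem_head orbT.
  by rewrite mem_word => /andP [_ /eqP].
have [la' [P' S' C' add']] := remove_nodeP P sM sx.
have sM' : sumn la' < M by lia.
have st' : steps (cnt M la').
  by apply: cnt_steps => //; have := size_le_sumn P'; lia.
have [xE1 xE2] : C x.+1 = C x /\ C x.+2 = (C x).+1 by move/(sgnP _ _ st): sx.
exists i, la'; split=> //.
  move=> y Hy; have xy : C y <= y := Cid y.
  rewrite !C' -!/C in Hy *.
  have [/eqP Ey|ny] := boolP (y == x.+1).
    by move: Hy; rewrite Ey eqxx; have := steps_add x.+1 d st; lia.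
  rewrite (negPf ny) addn0 in Hy *.
  have [Ex|nx] := eqVneq (y + d) x.+1; last by apply: reg; rewrite (negPf nx) in Hy; lia.
  apply/eqP; rewrite eqn_leq xy leqNgt; apply/negP => gap.
  case: y Hy xy ny gap Ex => [|y] Hy xy ny gap Ex; first by [].
  (* The only dangerous case: the bead arriving at [x] completes a run of [d] beads. Then the
     diagonal of the gap under that run also carries an R. *)
  have sy : sgn C y = Some false.
    have Hd : C (y.+1 + d.-1) = C y.+1 + d.-1.
      have -> : y.+1 + d.-1 = x by lia.
      by move: Hy; rewrite Ex eqxx xE1; lia.
    have H1 : C y.+2 = (C y.+1).+1.
      have := steps_add y.+2 d.-2 st; have := st y.+1.
      have -> : y.+2 + d.-2 = y.+1 + d.-1 by lia.
      lia.
    apply/(sgnP _ _ st) => /=; have := st y.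
    have [Eyy|] := eqVneq (C y.+1) (C y); first by lia.
    move=> ne1 st1; have := reg y; have -> : y + d = y.+1 + d.-1 by lia.
    by rewrite Hd; have := Cid y; lia.
  have yc : res M d i y.
    move: xc; rewrite mem_class /res => /andP [_ /eqP <-].
    have -> : (x.+1%:Z - M%:Z = y.+1%:Z - M%:Z + d%:Z)%R by lia.
    by rewrite modzDr.
  have yx : y < x by lia.
  have [s Es'] := class_split yx yc.
  (* This diagonal is [x - d], the last of the class before [x], so its R would survive in [w1],
     contradicting [R0]. *)
  have s0 : s = [::].
    case: s Es' => // z s Es'.
    have zc : z \in class M d i x by rewrite Es' mem_cat !inE eqxx !orbT.
    move: zc; rewrite mem_class => /andP [zx Rz].
    have := class_sorted M d i x; rewrite Es' (sorted_pairwise ltn_trans).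
    rewrite pairwise_cat => /and3P [_ _] /= /andP [/andP [yz _] _].
    by have := res_step yc Rz yz; lia.
  move: R0; rewrite Ew1 Es1 Es' s0 word_cat numR_cat /word /= sy /=.
  by rewrite numR1; lia.
rewrite (ftilde1E i P' sM' (leqnn _) d2) Es word_cat -cat1s word_cat.
have E y : y \in class M d i M.*2 -> y != x -> sgn (cnt M la') y = sgn C y.
  move=> yc yx; have := class_apart d2 xc yc; rewrite eq_sym yx => /(_ isT) H.
  have H1 : (y == x.+1) = false by lia.
  have H2 : (y.+1 == x.+1) = false by lia.
  have H3 : (y.+2 == x.+1) = false by lia.
  by apply: eq_sgn; rewrite C' ?H1 ?H2 ?H3 addn0.
have xs1 : x \notin s1 by rewrite Es1 mem_class ltnn.
have xs2 : x \notin s2.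
  have := class_sorted M d i M.*2; rewrite Es (sorted_pairwise ltn_trans).
  rewrite pairwise_cat => /and3P [_ _] /= /andP [/allP H _].
  by apply/negP => /H /=; rewrite ltnn.
have -> : word (sgn (cnt M la')) s1 = w1.
  rewrite Ew1; apply: eq_in_word => y ys; apply: E.
    by rewrite Es mem_cat ys.
  by apply: contraNneq xs1 => <-.
have -> : word (sgn (cnt M la')) s2 = w2.
  rewrite Ew2; apply: eq_in_word => y ys; apply: E.
    by rewrite Es mem_cat inE ys !orbT.
  by apply: contraNneq xs2 => <-.
have sx' : sgn (cnt M la') x = Some true.
  by apply/(sgnP _ _ st'); rewrite !C' -!/C eqxx; lia.
have -> : word (sgn (cnt M la')) [:: x] = [:: (true, x)].
  by rewrite /word /= sx'.
by rewrite (good_addable_mid _ R0 A0) /= /move1 add'.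
Qed.

(** Needed because the involution [m] is specified on values of words. *)
Lemma regular_fword1 d la : 2 <= d -> regular d la ->
  exists w, fword1 d w = Some la.
Proof.
move=> d2 R; have /andP [P _] := R; pose M := (sumn la).+1.
have reg : bead_regular d (cnt M la).
  apply: regular_bead_regular => //; first by lia.
  by apply: leqW; exact: size_le_sumn.
have : sumn la < M by [].
elim: {R}(sumn la) {-2}la (erefl (sumn la)) P reg => [|n IH] l Sl P reg lM.
  exists [::]; have := size_le_sumn P; rewrite Sl leqn0 size_eq0 => /eqP -> //.
have l0 : l != [::] by apply: contra_eqN Sl => /eqP ->.
have [i [l' [P' S' reg' E]]] := regular_predecessor d2 P lM reg l0.
have S2 : sumn l' = n by lia.
have [|w Ew] := IH l' S2 P' reg'; first by lia.
by exists (i :: w); rewrite /= Ew /= E.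
Qed.

(** * The bipartitions (la, la) *)

(** Gathers what is needed about one level 1 step: in the class of [i] the letter at [x] turns from
    A into R and all others stay. *)
Lemma ftilde1_step M d i la la' : is_partition la -> (sumn la).+1 < M -> 2 <= d ->
    ftilde1 d i la = Some la' -> exists x s1 s2,
  [/\ class M d i M.*2 = s1 ++ x :: s2,
      [/\ sgn (cnt M la) x = Some true, numR (word (sgn (cnt M la)) s1) = 0
        & numA (word (sgn (cnt M la)) s2) = 0],
      la' = move1 M la x,
      is_partition la' /\ sumn la' = (sumn la).+1
    & [/\ cnt M la' =1 drop_at (cnt M la) x true, sgn (cnt M la') x = Some false
        & forall y, y \in class M d i M.*2 -> y != x ->
            sgn (cnt M la') y = sgn (cnt M la) y]].
Proof.
move=> P sM d2; have sM' := ltnW sM.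
have sizeM : size la < M by exact: leq_ltn_trans (size_le_sumn P) sM'.
have st := cnt_steps P (ltnW sizeM).
rewrite (ftilde1E i P sM' (leqnn _) d2); case E: good_addable => [x|] //= [<-].
have [w1 [w2 [Ew R0 A0]]] := good_addable_split E.
have [s1 [s2 [Es E1 E2]]] := word_split Ew.
have xc : x \in class M d i M.*2 by rewrite Es mem_cat mem_head orbT.
have sx : sgn (cnt M la) x = Some true.
  have : (true, x) \in word (sgn (cnt M la)) (class M d i M.*2).
    by rewrite Ew mem_cat mem_head orbT.
  by rewrite mem_word => /andP [_ /eqP].
have [P' S' C'] := add_nodeP P sM' sx.
exists x, s1, s2; split; rewrite -?E1 -?E2 //.
have st' : steps (cnt M (move1 M la x)).
  by apply: cnt_steps => //; have := size_le_sumn P'; rewrite /move1 in P' *; lia.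
split=> [y||y yc yx]; first exact: C'.
  apply/(sgnP _ _ st'); rewrite !C' eqxx; move/(sgnP _ _ st): sx => [H1 H2].
  have -> : (x == x.+1) = false by lia.
  have -> : (x.+2 == x.+1) = false by lia.
  by lia.
have := class_apart d2 xc yc; rewrite eq_sym yx => /(_ isT) H.
have H1 : (y == x.+1) = false by lia.
have H2 : (y.+1 == x.+1) = false by lia.
have H3 : (y.+2 == x.+1) = false by lia.
by apply: eq_sgn; rewrite C' ?H1 ?H2 ?H3 subn0.
Qed.

Lemma fword1_partition d w la : 2 <= d -> fword1 d w = Some la ->
  is_partition la /\ sumn la = size w.
Proof.
move=> d2; elim: w la => [|i w IH] la /=; first by move=> [<-].
case E: fword1 => [l|] //= /ftilde1_step; have [P <-] := IH l E.
by move=> /(_ (sumn l).+2 P (ltnSn _) d2) [x [s1 [s2 [_ _ _ [] ]]]].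
Qed.

Section Double.
Variable T : Type.

(** The signature of (la, la) in charge (0, 0): every letter occurs twice, for component 2 and then
    for component 1. *)
Definition double_word (w : seq (bool * T)) : seq (bool * (T * bool)) :=
  flatten [seq [:: (l.1, (l.2, true)); (l.1, (l.2, false))] | l <- w].

Lemma reduce_word_double w : reduce_word (double_word w) = double_word (reduce_word w).
Proof.
elim: w => //= -[b x] w IH; rewrite /= {}IH.
by case: b; case: (reduce_word w) => [|[[] y] r].
Qed.

Lemma numA_double w : numA (double_word w) = (numA w).*2.
Proof.
rewrite /numA reduce_word_double; elim: (reduce_word w) => //= l r.
by rewrite /double_word /= => ->; case: l.1; lia.
Qed.

Lemma numR_double w : numR (double_word w) = (numR w).*2.
Proof.
rewrite /numR reduce_word_double; elim: (reduce_word w) => //= l r.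
by rewrite /double_word /= => ->; case: l.1; lia.
Qed.

Lemma double_cat w1 w2 : double_word (w1 ++ w2) = double_word w1 ++ double_word w2.
Proof. by rewrite /double_word map_cat flatten_cat. Qed.

End Double.

Lemma word_pair_slots (sg : nat -> option bool) sg2 s :
    (forall y c, y \in s -> sg2 (y, c) = sg y) ->
  word sg2 (pair_slots true s) = double_word (word sg s).
Proof.
elim: s => //= y s IH H; rewrite (H y true) ?mem_head // (H y false) ?mem_head //.
rewrite -/(word _ _) IH => [|z c zs]; last by apply: H; rewrite inE zs orbT.
by case: (sg y).
Qed.

(** The first f_i takes the copy of [x] in component 1, the later one in reading order. Its diagonal
    then reads AR, where nothing cancels, so the second f_i takes the copy in component 2. *)
Lemma double_ftilde2 d i la la' : is_partition la -> 2 <= d ->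
    ftilde1 d i la = Some la' ->
  obind (ftilde2 d (charge 0) i) (ftilde2 d (charge 0) i (la, la)) = Some (la', la').
Proof.
move=> P d2 E; pose M := ((sumn la).*2).+3.
have sM : (sumn la).+1 < M by rewrite /M; lia.
have [x [s1 [s2 [Es [sx R0 A0] Ela [P' S'] [C' sx' Co]]]]] := ftilde1_step P sM d2 E.
have B : bipart (sumn la).*2 (la, la) by split=> //; rewrite /rank /= addnn.
have B' : bipart (sumn la).*2.+1 (la', la).
  by split=> //; rewrite /rank /= S' -addnn addSn.
have nM : (sumn la).*2 < M by rewrite /M; lia.
have nM' : (sumn la).*2.+1 < M by rewrite /M; lia.
rewrite (ftilde2_charge (N := M.*2) i B nM) ?addn0 //.
have xs1 : x \notin s1 by rewrite (class_cat Es) mem_class ltnn.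
have xs2 : x \notin s2.
  have := class_sorted M d i M.*2; rewrite Es (sorted_pairwise ltn_trans).
  rewrite pairwise_cat => /and3P [_ _] /= /andP [/allP H _].
  by apply/negP => /H /=; rewrite ltnn.
have W1 : word (sgn2 (offs M 0) (la, la)) (pair_slots true (class M d i M.*2))
  = (double_word (word (sgn (cnt M la)) s1) ++ [:: (true, (x, true))])
    ++ (true, (x, false)) :: double_word (word (sgn (cnt M la)) s2).
  rewrite (@word_pair_slots (sgn (cnt M la))).
    rewrite Es word_cat -cat1s word_cat !double_cat -catA /=.
    by rewrite {2}/word /= sx.
  by move=> y c _; rewrite /sgn2; case: c; rewrite /= ?addn0.
rewrite W1 good_addable_mid; first last.
- by rewrite numA_double A0.
- by rewrite numR_cat numR_double R0 numR1; lia.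
rewrite /= {1}/move2 /= -Ela (ftilde2_charge (N := M.*2) i B' nM') ?addn0 //.
have W2 : word (sgn2 (offs M 0) (la', la)) (pair_slots true (class M d i M.*2))
  = double_word (word (sgn (cnt M la)) s1) ++ (true, (x, true)) ::
    ((false, (x, false)) :: double_word (word (sgn (cnt M la)) s2)).
  have -> : pair_slots true (class M d i M.*2)
      = pair_slots true s1 ++ [:: (x, true)] ++ [:: (x, false)] ++ pair_slots true s2.
    by rewrite Es /pair_slots map_cat flatten_cat.
  rewrite !word_cat.
  have co s : {subset s <= class M d i M.*2} -> x \notin s ->
    word (sgn2 (offs M 0) (la', la)) (pair_slots true s)
      = double_word (word (sgn (cnt M la)) s).
    move=> sub nx; apply: word_pair_slots => y c ys; rewrite /sgn2.
    case: c; rewrite /= ?addn0 // Co //; first exact: sub.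
    by apply: contraNneq nx => <-.
  rewrite !co //; try by move=> y ys; rewrite Es mem_cat ?inE ys ?orbT.
  by congr (_ ++ _); rewrite /word /= /sgn2 /= addn0 sx sx'.
rewrite W2 good_addable_mid; first last.
- by rewrite -cat1s numA_cat numA_double A0 numA1.
- by rewrite numR_double R0.
by rewrite /= /move2 /= addn0 -Ela.
Qed.

(** If a - i = q e, exactly one of q and q + 1 is even. *)
Lemma residue_split (e : nat) (a i : int) : 2 <= e ->
  let r := (a == i %[mod e])%Z in
  let r0 := (a == i %[mod (2 * e)%N])%Z in
  let r1 := (a + e%:Z == i %[mod (2 * e)%N])%R%Z in
  (r0 = r && ~~ r1) /\ (r1 = r && ~~ r0).
Proof.
move=> e2 /=; rewrite !eqz_mod_dvd.
have d1 (b : int) : ((2 * e)%N%:Z %| b)%Z -> (e %| b)%Z.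
  by apply: dvdz_trans; rewrite PoszM dvdz_mull.
have [/dvdzP [q Eq]|H] := boolP (e %| (a - i)%R)%Z; last first.
  have -> : ((2 * e)%N %| (a - i)%R)%Z = false by apply: contraNF H; exact: d1.
  suff -> : ((2 * e)%N %| (a + e%:Z - i)%R)%Z = false by [].
  apply: contraNF H => /d1; have -> : (a + e%:Z - i = a - i + e%:Z)%R by lia.
  by rewrite rpredDr // dvdzz.
have -> : (a + e%:Z - i = (q + 1) * e%:Z)%R by rewrite mulrDl mul1r -Eq; lia.
rewrite Eq PoszM !dvdz_mul2r; lia.
Qed.

Definition staggered (e M : nat) (i : int) (j : nat) : nat * bool :=
  (j, ~~ res M (2 * e) i j).

(* A diagonal of residue i mod e contributes to the i-word modulo 2e through
   exactly one of the two components. *)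
Lemma ftilde2_staggered e M i n bl : 2 <= e -> bipart n bl -> n < M ->
  ftilde2 (2 * e) (charge e) i bl = omap (move2 (fun=> M) bl)
    (good_addable (word (sgn2 (fun=> M) bl)
      (map (staggered e M i) (class M e i M.*2)))).
Proof.
move=> e2 B nM; apply: (ftilde2E B) => //.
  rewrite sorted_map.
  apply: (@sub_in_sorted _ (mem (class M e i M.*2)) ltn); last exact: class_sorted.
  2: by apply/allP.
  move=> j j'; rewrite !mem_class => /andP [_ R] /andP [_ R'] jj'.
  have := res_step R R' jj'; rewrite /= /slot_key /=.
  by case: (res M _ i j); case: (res M _ i j') => /=; lia.
move=> [j c]; rewrite /sgn2 /= => H.
have [P le_n] := bipart_component c B.
have jN : j < M.*2.
  case E: (sgn _ j) H => [b|] // _; apply: (sgn_lt P _ (leqnn _) E).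
  exact: leq_ltn_trans le_n nM.
have -> : ((j, c) \in map (staggered e M i) (class M e i M.*2))
    = (j \in class M e i M.*2) && (c == ~~ res M (2 * e) i j).
  apply/mapP/andP; first by case=> k kc [-> ->].
  by move=> [jc /eqP ->]; exists j.
rewrite mem_class jN /slot_res /res /=.
have := residue_split (j.+1%:Z - M%:Z)%R i e2; rewrite /=.
case: c {P le_n H} => /=; rewrite ?addr0;
case: (_ == _ %[mod e])%Z; case: (_ == _ %[mod (2 * e)%N])%Z;
case: (_ + _ == _ %[mod (2 * e)%N])%Z => -[] //=.
Qed.

(** With equal components it does not matter which one a diagonal is read from, so the signature
    modulo 2e is that of [la] modulo e. Residues [i1] and [i] read each diagonal from opposite
    components, so the second step still finds the A at [x]. *)
Lemma staggered_ftilde2 e (i i1 : int) la la' : 2 <= e -> is_partition la ->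
    (i1 == (i + e%:Z)%R %[mod (2 * e)%N])%Z -> ftilde1 e i la = Some la' ->
  obind (ftilde2 (2 * e) (charge e) i) (ftilde2 (2 * e) (charge e) i1 (la, la))
    = Some (la', la').
Proof.
move=> e2 P Ei E; pose M := ((sumn la).*2).+3.
have sM : (sumn la).+1 < M by rewrite /M; lia.
have [x [s1 [s2 [Es [sx R0 A0] Ela [P' S'] [C' sx' Co]]]]] := ftilde1_step P sM e2 E.
have res1 j : res M e i1 j = res M e i j /\
    (res M e i j -> res M (2 * e) i1 j = ~~ res M (2 * e) i j).
  have [F0 F1] := residue_split (j.+1%:Z - M%:Z)%R i e2.
  have F2 : res M (2 * e) i1 j
      = (j.+1%:Z - M%:Z + e%:Z == i %[mod (2 * e)%N])%R%Z.
    rewrite /res (eqP Ei) !eqz_mod_dvd.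
    have -> : (j.+1%:Z - M%:Z + e%:Z - i = j.+1%:Z - M%:Z - (i + e%:Z) + (2 * e)%N%:Z)%R by lia.
    by rewrite [RHS]rpredDr ?dvdzz.
  split; last by move=> R; rewrite F2 F1 -/(res M e i j) R.
  rewrite /res !eqz_mod_dvd.
  have H : (e %| (i1 - (i + e%:Z))%R)%Z.
    move: Ei; rewrite eqz_mod_dvd; apply: dvdz_trans.
    by rewrite PoszM dvdz_mull.
  have -> : (j.+1%:Z - M%:Z - i1 = j.+1%:Z - M%:Z - i - e%:Z - (i1 - (i + e%:Z)))%R by lia.
  by rewrite [LHS]rpredBr // [LHS]rpredBr // dvdzz.
have cl : class M e i1 M.*2 = class M e i M.*2.
  by apply: eq_filter => j; case: (res1 j).
have B : bipart (sumn la).*2 (la, la) by split=> //; rewrite /rank /= addnn.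
have nM : (sumn la).*2 < M by rewrite /M; lia.
have nM' : (sumn la).*2.+1 < M by rewrite /M; lia.
have xc : x \in class M e i M.*2 by rewrite Es mem_cat mem_head orbT.
have Rc y : y \in class M e i M.*2 -> res M e i y by rewrite mem_class => /andP [].
have good : good_addable (word (sgn (cnt M la)) (class M e i M.*2)) = Some x.
  rewrite Es word_cat -cat1s word_cat.
  have -> : word (sgn (cnt M la)) [:: x] = [:: (true, x)] by rewrite /word /= sx.
  exact: good_addable_mid R0 A0.
pose c := res M (2 * e) i x.
have E1 : ftilde2 (2 * e) (charge e) i1 (la, la) = Some (upd_component (la, la) c la').
  rewrite (ftilde2_staggered i1 e2 B nM) cl word_map good_addable_map.
  rewrite (@eq_in_word _ _ (sgn (cnt M la))); last first.
    by move=> y _; rewrite /sgn2 /=; case: (~~ _).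
  rewrite good /= /move2 /= (proj2 (res1 x)) ?negbK ?Rc // -/c.
  by rewrite Ela; case: (c).
rewrite E1 /=; set b := upd_component _ _ _.
have B' : bipart (sumn la).*2.+1 b.
  by rewrite /b; case: (c); split=> //; rewrite /rank /= S' -addnn ?addSn ?addnS.
rewrite (ftilde2_staggered i e2 B' nM') word_map good_addable_map.
rewrite (@eq_in_word _ _ (sgn (cnt M la))); last first.
  move=> y yc; rewrite /sgn2 /= /b.
  have [->|yx] := eqVneq y x; first by rewrite -/c; case: (c).
  by case: (c); case: (~~ _) => //=; rewrite Co.
rewrite good /= /move2 /= -/c /b; congr Some.
by case: (c); rewrite /= -Ela.
Qed.

(** * Large charges *)

(** [phi] and [eps] are the string lengths of crystal theory: how often f_i, respectively e_i, can
    be applied. *)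
Definition phi (d : nat) (i : int) (la : seq nat) := numA (signature1 d i la).
Definition eps (d : nat) (i : int) (la : seq nat) := numR (signature1 d i la).

Lemma signature1_congr (d : nat) (i i' : int) la : (i == i' %[mod d])%Z ->
  signature1 d i la = signature1 d i' la.
Proof.
move=> /eqP E; rewrite /signature1; congr sort; apply: eq_filter => u.
by rewrite /has_residue1 E.
Qed.

Lemma ftilde1_congr (d : nat) (i i' : int) la : (i == i' %[mod d])%Z ->
  ftilde1 d i la = ftilde1 d i' la.
Proof. by rewrite /ftilde1 => /signature1_congr ->. Qed.

Lemma phi_congr (d : nat) (i i' : int) la : (i == i' %[mod d])%Z ->
  phi d i la = phi d i' la.
Proof. by rewrite /phi => /signature1_congr ->. Qed.

Lemma ftilde1_phi d i la : isSome (ftilde1 d i la) = (0 < phi d i la).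
Proof. by rewrite /phi -good_addable_gt0 /ftilde1; case: good_addable. Qed.

Lemma phi_ftilde1 d i la la' : 2 <= d -> is_partition la ->
  ftilde1 d i la = Some la' -> phi d i la = (phi d i la').+1.
Proof.
move=> d2 P E; pose M := (sumn la).+2; have sM : (sumn la).+1 < M by [].
have [x [s1 [s2 [Es [sx R0 A0] Ela [P' S'] [C' sx' Co]]]]] := ftilde1_step P sM d2 E.
rewrite /phi (signature1E i P (ltnW sM) (leqnn _) d2).
rewrite (signature1E i P' (_ : sumn la' < M) (leqnn _) d2); last by rewrite S'.
rewrite !numA_map Es -[x :: s2]cat1s !word_cat.
have [xs1 xs2] : x \notin s1 /\ x \notin s2.
  have : uniq (s1 ++ x :: s2) by rewrite -Es; apply/filter_uniq/iota_uniq.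
  by rewrite cat_uniq /= => /and3P [_ /norP [? _] /andP []].
have co s : {subset s <= class M d i M.*2} -> x \notin s ->
    word (sgn (cnt M la')) s = word (sgn (cnt M la)) s.
  move=> sub nx; apply: eq_in_word => y ys; apply: Co; first exact: sub.
  by apply: contraNneq nx => <-.
rewrite (co s1) //; last by move=> y ys; rewrite Es mem_cat ys.
rewrite (co s2) //; last by move=> y ys; rewrite Es mem_cat inE ys !orbT.
have -> : word (sgn (cnt M la)) [:: x] = [:: (true, x)] by rewrite /word /= sx.
have -> : word (sgn (cnt M la')) [:: x] = [:: (false, x)] by rewrite /word /= sx'.
by have [_ -> _] := flip_mid x R0 A0.
Qed.

(* For T large the crystal in charge (0, T) is a tensor product. *)
Lemma ftilde2_asymptotic d T i n bl : 2 <= d -> bipart n bl -> n.+1.*2 <= T ->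
  ftilde2 d (charge T) i bl =
    if eps d i bl.1 < phi d (i - T%:Z)%R bl.2
    then omap (fun la => (bl.1, la)) (ftilde1 d (i - T%:Z)%R bl.2)
    else omap (fun la => (la, bl.2)) (ftilde1 d i bl.1).
Proof.
move=> d2 B nT; pose M := n.+1; have nM : n < M by [].
have [P1 l1] := bipart_component false B; have [P2 l2] := bipart_component true B.
rewrite /= in P1 P2 l1 l2.
(* All letters lie at positions below 2M, and T is at least 2M, so the whole of component 1 is read
   before component 2. *)
pose S := [seq (j, false) | j <- class M d i M.*2]
          ++ [seq (j, true) | j <- class M d (i - T%:Z)%R M.*2].
have small j : (j \in class M d i M.*2) || (j \in class M d (i - T%:Z)%R M.*2) -> j < M.*2.
  by rewrite !mem_class => /orP [] /andP [].
rewrite (@ftilde2E (fun=> M) _ d i n bl S B) //; first last.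
- move=> [j c]; rewrite /sgn2 /= => H.
  have [P le_n] := bipart_component c B.
  have jN : j < M.*2.
    case E: (sgn _ j) H => [b|] // _; apply: (sgn_lt P _ (leqnn _) E).
    exact: leq_ltn_trans le_n nM.
  rewrite mem_cat; case: c {P le_n H}.
    have -> : ((j, true) \in [seq (j, false) | j <- class M d i M.*2]) = false.
      by apply/negP => /mapP [].
    rewrite mem_map; last by move=> ? ? [].
    rewrite mem_class jN /slot_res /res /= !eqz_mod_dvd; congr (_ %| _)%Z; lia.
  have -> : ((j, false) \in [seq (j, true) | j <- class M d (i - T%:Z)%R M.*2]) = false.
    by apply/negP => /mapP [].
  rewrite orbF mem_map; last by move=> ? ? [].
  by rewrite mem_class jN /slot_res /res /= addr0.
- pose K := slot_key (fun=> M) (charge T).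
  have tr : transitive (fun x y => (K x < K y)%R).
    by move=> x y z; exact: lt_trans.
  rewrite (sorted_pairwise tr) pairwise_cat -!(sorted_pairwise tr).
  apply/and3P; split.
  + apply/allrelP => _ _ /mapP [j jc ->] /mapP [j' jc' ->].
    have := small j; rewrite jc => /(_ isT); rewrite /K /slot_key /= /M.
    by lia.
  + rewrite sorted_map; apply: sub_sorted (class_sorted M d i M.*2) => j j' /=.
    by rewrite /K /slot_key /=; lia.
  rewrite sorted_map; apply: sub_sorted (class_sorted M d (i - T%:Z)%R M.*2) => j j' /=.
  by rewrite /K /slot_key /=; lia.
rewrite word_cat !word_map good_addable_cat.
rewrite (numA_map (fun j => (j, true))) (numR_map (fun j => (j, false))).
rewrite (good_addable_map (fun j => (j, true))) (good_addable_map (fun j => (j, false))).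
rewrite (ftilde1E _ P1 (leq_ltn_trans l1 nM) (leqnn _) d2).
rewrite (ftilde1E _ P2 (leq_ltn_trans l2 nM) (leqnn _) d2).
rewrite /eps /phi (signature1E _ P1 (leq_ltn_trans l1 nM) (leqnn _) d2) numR_map.
rewrite (signature1E _ P2 (leq_ltn_trans l2 nM) (leqnn _) d2) numA_map.
case: ifP => _; by case: good_addable.
Qed.

Lemma fword2_bipart d t w bl : 2 <= d -> fword2 d (charge t) w = Some bl ->
  bipart (size w) bl.
Proof.
by move=> d2 /(transfer_fword2 (ltnSn _) d2) [bl' []].
Qed.

(** A large charge enters the tensor product rule only through the residue i - T. *)
Lemma fword2_stable (d T T' : nat) w : 2 <= d -> (size w).*2 <= T -> (size w).*2 <= T' ->
    (T%:Z == T'%:Z %[mod d])%Z ->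
  fword2 d (charge T) w = fword2 d (charge T') w.
Proof.
move=> d2 + + TT'; elim: w => // i w IH /= wT wT'.
rewrite -IH; [|lia|lia]; case E: (fword2 _ _ w) => [bl|] //=.
have B := fword2_bipart d2 E.
rewrite (ftilde2_asymptotic i d2 B wT) (ftilde2_asymptotic i d2 B wT').
have c : (i - T%:Z == i - T'%:Z %[mod d])%Z%R.
  move: TT'; rewrite !eqz_mod_dvd.
  have -> : (i - T%:Z - (i - T'%:Z) = - (T%:Z - T'%:Z))%R by lia.
  by rewrite rpredN.
by rewrite (phi_congr _ c) (ftilde1_congr _ c).
Qed.

(** * Negation of residues *)

(** The pairing of the weight with the simple coroot h_i: each summand is the bead at [j] minus the
    bead at [j + 1]. *)
Definition weight (M d : nat) (i : int) (C : nat -> nat) : int :=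
  (\sum_(j <- class M d i M.*2) ((C j.+1).*2%:Z - (C j)%:Z - (C j.+2)%:Z))%R.

Lemma phi_eps_weight M d i la : 2 <= d -> is_partition la -> sumn la < M ->
  ((phi d i la)%:Z - (eps d i la)%:Z)%R = weight M d i (cnt M la).
Proof.
move=> d2 P sM; rewrite /phi /eps (signature1E i P sM (leqnn _) d2).
have st : steps (cnt M la).
  by apply: cnt_steps => //; have := size_le_sumn P; lia.
rewrite numA_map numR_map /weight; set s := class _ _ _ _; set w := word _ s.
have -> : ((numA w)%:Z - (numR w)%:Z = (count fst w)%:Z - (count (fun l => ~~ l.1) w)%:Z)%R.
  by have := numA_numR w; lia.
rewrite /w; elim: s {w} => [|j s IH]; first by rewrite big_nil.
rewrite big_cons -IH -cat1s word_cat !count_cat.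
have -> : ((cnt M la j.+1).*2%:Z - (cnt M la j)%:Z - (cnt M la j.+2)%:Z
  = (count fst (word (sgn (cnt M la)) [:: j]))%:Z
    - (count (fun l => ~~ l.1) (word (sgn (cnt M la)) [:: j]))%:Z)%R.
  rewrite /word /= /sgn /bead; have := st j; have := st j.+1.
  by case: ltnP => ?; case: ltnP => ? /=; lia.
by lia.
Qed.

Definition cong (d : nat) (a b : int) : nat := (a == b %[mod d])%Z.

Lemma cong_opp d a b : cong d (- a)%R (- b)%R = cong d a b.
Proof.
congr nat_of_bool; rewrite !eqz_mod_dvd.
have -> : (- a - - b = - (a - b))%R by lia.
by rewrite rpredN.
Qed.

Lemma sum_pred1 (s : seq nat) a : uniq s ->
  (\sum_(j <- s) Posz (j == a))%R = Posz (a \in s).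
Proof.
elim: s => [|j s IH] /=; first by rewrite big_nil.
move=> /andP [js us]; rewrite big_cons IH // inE eq_sym.
by case: eqP => [->|] //=; rewrite (negPf js).
Qed.

Lemma mem_class_cong M d k i x y N (u : int) : res M d k x -> y < N ->
  (y%:Z = x%:Z + u)%R ->
  nat_of_bool (y \in class M d i N) = cong d (k + u)%R i.
Proof.
rewrite mem_class /res /cong => R -> Ey; congr nat_of_bool; move: R.
rewrite !eqz_mod_dvd => R.
have -> : (y.+1%:Z - M%:Z - i = (x.+1%:Z - M%:Z - k) + (k + u - i))%R by lia.
by rewrite rpredDl.
Qed.

(** Applying f_k subtracts the simple root of k, so a column of the affine Cartan matrix appears.
    Counting k + 1 and k - 1 separately also covers d = 2, where they coincide. *)
Lemma weight_ftilde1 M d k i la la' : 2 <= d -> is_partition la ->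
    (sumn la).+1 < M -> ftilde1 d k la = Some la' ->
  weight M d i (cnt M la') = (weight M d i (cnt M la)
    - (cong d k i).*2%:Z + (cong d (k + 1) i)%:Z + (cong d (k - 1) i)%:Z)%R.
Proof.
move=> d2 P sM /(ftilde1_step P sM d2) [x [s1 [s2 [Es [sx _ _] _ _ [C' _ _]]]]].
have sizeM : size la < M by have := size_le_sumn P; lia.
have [x1 x2] := sgn_bounds P sizeM sx.
have lx := nth_le_sumn la 0; have sla := size_le_sumn P.
have Rx : res M d k x.
  have : x \in class M d k M.*2 by rewrite Es mem_cat mem_head orbT.
  by rewrite mem_class => /andP [].
have st : steps (cnt M la) by exact: cnt_steps (ltnW sizeM).
have Cx : cnt M la x.+1 = (cnt M la x).+1 by move/(sgnP _ _ st): sx => [].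
have u : uniq (class M d i M.*2) by apply/filter_uniq/iota_uniq.
have e0 : nat_of_bool (x \in class M d i M.*2) = cong d k i.
  by rewrite (mem_class_cong (u := 0%R) i Rx) ?addr0 //; lia.
rewrite -e0 -(@mem_class_cong M d k i x x.+1 M.*2 1%R Rx); [|lia|lia].
rewrite -(@mem_class_cong M d k i x x.-1 M.*2 (-1)%R Rx); [|lia|lia].
rewrite -muln2 PoszM -!(sum_pred1 _ u) mulr_suml -sumrN -!big_split /=.
apply: eq_bigr => j _; rewrite !C' /drop_at /= !eqSS.
have Cpos : 0 < cnt M la x.+1 by rewrite Cx.
have [->|nj] := eqVneq j x; first by move: Cpos; lia.
have [->|nj1] := eqVneq j x.+1; first by move: Cpos; lia.
have [Ej|nj2] := eqVneq j.+1 x; first by move: Cpos; rewrite -Ej; lia.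
by lia.
Qed.

Definition opp_word (w : seq int) : seq int := [seq (- i)%R | i <- w].

Lemma opp_wordK : involutive opp_word.
Proof. by move=> w; rewrite /opp_word -map_comp map_id_in // => i _ /=; exact: opprK. Qed.

Lemma weight_nil M d i : 2 <= M -> weight M d i (cnt M [::]) = (cong d 0 i)%:Z%R.
Proof.
move=> M2; rewrite /weight.
have u : uniq (class M d i M.*2) by apply/filter_uniq/iota_uniq.
rewrite (eq_bigr (fun j => Posz (j == M.-1))); last first.
  by move=> j _; rewrite !cnt_nil; lia.
rewrite sum_pred1 // mem_class /res /cong.
have -> : (M.-1.+1%:Z - M%:Z = 0)%R by lia.
by have -> : M.-1 < M.*2 by lia.
Qed.

(** Negation exchanges the terms for k + 1 and k - 1, so the Cartan matrix is invariant. *)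
Lemma weight_opp M d i w la la' : 2 <= d -> (size w).+1 < M ->
    fword1 d w = Some la -> fword1 d (opp_word w) = Some la' ->
  weight M d i (cnt M la) = weight M d (- i)%R (cnt M la').
Proof.
move=> d2; elim: w la la' i => [|k w IH] la la' i wM /=.
  move=> [<-] [<-]; rewrite !weight_nil; [|lia|lia].
  by rewrite -cong_opp oppr0.
case E: (fword1 d w) => [l|] //= El; case E': (fword1 d _) => [l'|] //= El'.
have [P S] := fword1_partition d2 E; have [P' S'] := fword1_partition d2 E'.
rewrite size_map in S'; rewrite /= in wM.
have lM : (sumn l).+1 < M by rewrite S ltnW.
have lM' : (sumn l').+1 < M by rewrite S' ltnW.
rewrite (weight_ftilde1 i d2 P lM El) (weight_ftilde1 (- i)%R d2 P' lM' El').
rewrite (IH l l' i (ltnW wM)) //.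
have -> : (- k + 1 = - (k - 1))%R by lia.
have -> : (- k - 1 = - (k + 1))%R by lia.
by rewrite !cong_opp; lia.
Qed.

Section Mullineux.
Variables (d : nat) (m : seq nat -> seq nat).
Hypotheses (d2 : 2 <= d) (Hm : is_mullineux d m).

Lemma mullineux_fword1 w la : fword1 d w = Some la ->
  fword1 d (opp_word w) = Some (m la).
Proof. exact: Hm. Qed.

(* phi counts how often f_i can be applied, so it is determined by the set of
   words with nonzero value. *)
Lemma phi_mullineux i w la : fword1 d w = Some la ->
  phi d (- i)%R (m la) = phi d i la.
Proof.
move: {2}(phi d i la) (erefl (phi d i la)) => n; elim: n w la => [|n IH] w la En E.
  have E' := mullineux_fword1 E; rewrite En; apply/eqP; rewrite -leqn0 leqNgt.
  rewrite -ftilde1_phi; apply/negP; case E2: ftilde1 => [l|] // _.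
  have : fword1 d (opp_word (i :: w)) = Some l by rewrite /= E' /= E2.
  move/mullineux_fword1; rewrite opp_wordK /= E /= => E3.
  by have := ftilde1_phi d i la; rewrite E3 En.
have := ftilde1_phi d i la; rewrite En; case E1: ftilde1 => [l|] // _.
have El : fword1 d (i :: w) = Some l by rewrite /= E /= E1.
have [P _] := fword1_partition d2 E.
have E' := mullineux_fword1 E; have [P' _] := fword1_partition d2 E'.
have := mullineux_fword1 El; rewrite /= E' /= => E2.
have := phi_ftilde1 d2 P E1; have := phi_ftilde1 d2 P' E2.
by rewrite En => -> [/esym H]; rewrite (IH _ _ H El) H.
Qed.

(** By [phi_eps_weight], [eps] is [phi] minus the weight, and both are compatible with negation. *)
Lemma eps_mullineux i w la : fword1 d w = Some la ->
  eps d (- i)%R (m la) = eps d i la.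
Proof.
move=> E; have E' := mullineux_fword1 E.
have [P S] := fword1_partition d2 E; have [P' S'] := fword1_partition d2 E'.
rewrite size_map in S'; have [M wM] : exists M, (size w).+1 < M by exists (size w).+2.
have lM : sumn la < M by rewrite S ltnW.
have lM' : sumn (m la) < M by rewrite S' ltnW.
have := phi_eps_weight i d2 P lM; have := phi_eps_weight (- i)%R d2 P' lM'.
by rewrite (phi_mullineux i E) -(weight_opp i d2 wM E E'); lia.
Qed.

Lemma mullineux_asymptotic T w mu1 mu2 : (size w).*2 <= T ->
    (T%:Z == - T%:Z %[mod d])%R%Z ->
    fword2 d (charge T) w = Some (mu1, mu2) ->
  fword2 d (charge T) (opp_word w) = Some (m mu1, m mu2).
Proof.
move=> wT TT E.
(* The induction carries words for both components, since the facts about [m] hold for values of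
   words. *)
suff [u1 [u2 [_ _ ->]]] : exists u1 u2, [/\ fword1 d u1 = Some mu1,
  fword1 d u2 = Some mu2 & fword2 d (charge T) (opp_word w) = Some (m mu1, m mu2)] by [].
elim: w mu1 mu2 wT E => [|i w IH] mu1 mu2 wT.
  move=> [<- <-]; exists [::], [::]; split=> //=.
  by have /= [<-] := @mullineux_fword1 [::] [::] erefl.
rewrite /=; case E: fword2 => [[n1 n2]|] //= E2.
have [|u1 [u2 [F1 F2 F]]] := IH n1 n2 _ E; first by move: wT => /=; lia.
have B := fword2_bipart d2 E; have B' := fword2_bipart d2 F.
rewrite size_map in B'; rewrite F /=.
move: E2; rewrite (ftilde2_asymptotic i d2 B wT) (ftilde2_asymptotic _ d2 B' wT) /=.
have c : (- i - T%:Z == - (i - T%:Z) %[mod d])%R%Z.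
  move: TT; rewrite !eqz_mod_dvd.
  have -> : (- i - T%:Z - - (i - T%:Z) = - (T%:Z - - T%:Z))%R by lia.
  by rewrite rpredN.
rewrite (phi_congr _ c) (ftilde1_congr _ c).
rewrite (eps_mullineux i F1) (phi_mullineux _ F2); case: ifP => _.
  case G: ftilde1 => [l|] //= [<- <-].
  have F3 : fword1 d ((i - T%:Z)%R :: u2) = Some l by rewrite /= F2 /= G.
  have := mullineux_fword1 F3; rewrite /= (mullineux_fword1 F2) /= => ->.
  by exists u1, ((i - T%:Z)%R :: u2).
case G: ftilde1 => [l|] //= [<- <-].
have F3 : fword1 d (i :: u1) = Some l by rewrite /= F1 /= G.
have := mullineux_fword1 F3; rewrite /= (mullineux_fword1 F1) /= => ->.
by exists (i :: u1), u2.
Qed.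

End Mullineux.

(** * The maps psi *)

Lemma shift_chargeE d t k : shift_charge d (charge t) k = charge (t + k * d).
Proof. by rewrite /shift_charge /charge /= -PoszD. Qed.

Section Psi.
Variables (psi : nat -> int * int -> bipartition -> bipartition) (d : nat).
Hypotheses (d2 : 2 <= d) (Hpsi : forall s, is_crystal_iso d s (psi d s)).

(** Preservation of rank makes [psi] fix the empty bipartition; commutation with the f_i does the
    rest. *)
Lemma psi_fword2 t w bl : fword2 d (charge t) w = Some bl ->
  fword2 d (charge (t + d)) w = Some (psi d (charge t) bl).
Proof.
have := Hpsi (charge t); rewrite /is_crystal_iso shift_chargeE mul1n.
move=> [[maps _ _] rk Hf _]; elim: w bl => [|i w IH] bl.
  move=> /= [<-]; have U : uglov d (charge t) ([::], [::]) by exists [::].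
  have [w' Ew'] := maps _ U; have [_ _ R] := fword2_bipart d2 Ew'.
  have := rk _ U; rewrite R [rank _]/rank /= => /size0nil w0.
  by move: Ew'; rewrite w0.
rewrite /=; case E: (fword2 d (charge t) w) => [b|] //= Eb.
rewrite (IH b E) /= -Hf; last by exists w.
by rewrite Eb.
Qed.

Lemma psi_comp_fword2 t w bl k : fword2 d (charge t) w = Some bl ->
  fword2 d (charge (t + k * d)) w = Some (psi_comp psi d (charge t) k bl).
Proof.
move=> E; elim: k => [|k IH] /=; first by rewrite addn0.
by rewrite shift_chargeE mulSnr addnA (psi_fword2 IH).
Qed.

(** From twice the length of [w] onwards, congruent charges give [w] the same value, so the iterates
    of [psi] are eventually constant and [xget] returns their limit. *)
Lemma psi_tilde_fword2 t w bl k : fword2 d (charge t) w = Some bl ->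
    (size w).*2 <= t + k * d ->
  fword2 d (charge (t + k * d)) w = Some (psi_tilde psi d (charge t) bl).
Proof.
move=> E wk; rewrite (psi_comp_fword2 k E); congr Some; symmetry.
have stab k' : k <= k' ->
    psi_comp psi d (charge t) k' bl = psi_comp psi d (charge t) k bl.
  move=> kk'; apply: Some_inj; rewrite -!(psi_comp_fword2 _ E).
  apply: fword2_stable => //.
    by apply: leq_trans wk _; rewrite leq_add2l leq_mul2r kk' orbT.
  by rewrite !PoszD !PoszM ![(t%:Z + _)%R]addrC !modzMDl.
apply: xget_unique; first by exists k.
by move=> y [K HK]; rewrite -(HK (maxn K k) (leq_maxl _ _)) stab ?leq_maxr.
Qed.

End Psi.

(** * Words leading to (la, la) *)

Fixpoint doubled (s : int) (w : seq int) : seq int :=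
  if w is i :: w' then [:: i, (i + s)%R & doubled s w'] else [::].

(** Negation changes the shift e into -e, which is congruent to e modulo 2e; hence the free
    parameter [s]. *)
Lemma opp_doubled s w : opp_word (doubled s w) = doubled (- s)%R (opp_word w).
Proof. by elim: w => //= i w IH; rewrite IH opprD. Qed.

Lemma size_doubled s w : size (doubled s w) = (size w).*2.
Proof. by elim: w => //= i w ->; rewrite doubleS. Qed.

Lemma fword2_doubled d w la : 2 <= d -> fword1 d w = Some la ->
  fword2 d (charge 0) (doubled 0%R w) = Some (la, la).
Proof.
move=> d2; elim: w la => [|i w IH] la /=; first by move=> [<-].
case E: fword1 => [l|] //= El; rewrite (IH l E) /= addr0.
by have [P _] := fword1_partition d2 E; exact: double_ftilde2.
Qed.

Lemma fword2_staggered e (s : int) w la : 2 <= e ->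
    (s == e%:Z %[mod (2 * e)%N])%Z -> fword1 e w = Some la ->
  fword2 (2 * e) (charge e) (doubled s w) = Some (la, la).
Proof.
move=> e2 Es; elim: w la => [|i w IH] la /=; first by move=> [<-].
case E: fword1 => [l|] //= El; rewrite (IH l E) /=.
have [P _] := fword1_partition e2 E; apply: staggered_ftilde2 => //.
move: Es; rewrite !eqz_mod_dvd.
by have -> : (i + s - (i + e%:Z) = s - e%:Z)%R by lia.
Qed.

Theorem proposition5p5
  (m : nat -> seq nat -> seq nat)
  (psi : nat -> int * int -> bipartition -> bipartition)
  (Hm : forall d : nat, 2 <= d -> is_mullineux d (m d))
  (Hpsi : forall (d : nat) (s : int * int), 2 <= d -> is_crystal_iso d s (psi d s))
  (e : nat) (He : 2 <= e) (HC : statement_C)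
  (la : seq nat) (Hla : regular e la)
  (mu1 mu2 : seq nat)
  (Hmu : (mu1, mu2) = psi_tilde psi e (0, 0)%R (la, la)) :
  [/\ psi_tilde psi e (0, 0)%R (m e la, m e la)
        = psi_tilde psi (2 * e) (0, e%:Z)%R (m e la, m e la),
      psi_tilde psi (2 * e) (0, e%:Z)%R (m e la, m e la)
        = (m (2 * e) mu1, m (2 * e) mu2)
    & (m (2 * e) mu1, m (2 * e) mu2) = (m e mu1, m e mu2)].
Proof.
have He2 : 2 <= 2 * e by lia.
have Hpe s := Hpsi e s He; have Hp2e s := Hpsi (2 * e) s He2.
have [u Eu] := regular_fword1 He Hla.
have Eu' : fword1 e (opp_word u) = Some (m e la) := mullineux_fword1 (Hm e He) Eu.
have emod : (e%:Z == e%:Z %[mod (2 * e)%N])%Z by [].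
have emod' : (- e%:Z == e%:Z %[mod (2 * e)%N])%R%Z.
  rewrite eqz_mod_dvd; have -> : (- e%:Z - e%:Z = - (2 * e)%N%:Z)%R by lia.
  by rewrite rpredN dvdzz.
have F := fword2_doubled He Eu; have G := fword2_staggered He emod Eu.
have F' := fword2_doubled He Eu'; have G' := fword2_staggered He emod' Eu'.
(* Doubled words have length 2n, so their values settle from charge 4n on. The charges (2k + 1)e and
   e + 2ke used below are the same number, which is at least 4n. *)
pose n := size u; pose k := n.*2.*2.
have ke : k <= (2 * k).+1 * e by apply: leq_trans (leq_pmulr _ _); lia.
have ke2 : k <= e + k * (2 * e) by apply: leq_trans (leq_addl _ _); rewrite leq_pmulr; lia.
have S s v : size v = n -> (size (doubled s v)).*2 = k by rewrite size_doubled => ->.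
have S' : size (opp_word u) = n by rewrite size_map.
have A : fword2 e (charge ((2 * k).+1 * e)) (doubled 0%R u) = Some (mu1, mu2).
  by have := psi_tilde_fword2 (k := (2 * k).+1) He Hpe F; rewrite S // Hmu; apply.
have A' : fword2 e (charge ((2 * k).+1 * e)) (doubled 0%R (opp_word u))
    = Some (psi_tilde psi e (charge 0) (m e la, m e la)).
  by have := psi_tilde_fword2 (k := (2 * k).+1) He Hpe F'; rewrite S //; apply.
have B' : fword2 (2 * e) (charge (e + k * (2 * e))) (doubled (- e%:Z)%R (opp_word u))
    = Some (psi_tilde psi (2 * e) (charge e) (m e la, m e la)).
  by have := psi_tilde_fword2 (k := k) He2 Hp2e G'; rewrite S //; apply.
(* The 2e-crystal reaches the same (mu1, mu2), so residues can be negated there modulo 2e as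
   well. *)
have B : fword2 (2 * e) (charge (e + k * (2 * e))) (doubled e%:Z u) = Some (mu1, mu2).
  by rewrite -(fword2_routes HC He F G).
have E1 : psi_tilde psi e (charge 0) (m e la, m e la)
    = psi_tilde psi (2 * e) (charge e) (m e la, m e la).
  by have := fword2_routes HC He F' G' k; rewrite A' B' => -[].
have E2 : psi_tilde psi (2 * e) (charge e) (m e la, m e la) = (m (2 * e) mu1, m (2 * e) mu2).
  apply: Some_inj; rewrite -B' -opp_doubled; apply: (mullineux_asymptotic He2 (Hm _ He2)) => //.
    by rewrite S.
  rewrite eqz_mod_dvd.
  (* Twice the charge e + 2ke is (2k + 1) times 2e, hence 0 modulo 2e. *)
  have -> : ((e + k * (2 * e))%N%:Z - - (e + k * (2 * e))%N%:Z
    = (2 * k).+1%:Z * (2 * e)%N%:Z)%R by lia.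
  by rewrite dvdz_mull.
have E3 : psi_tilde psi e (charge 0) (m e la, m e la) = (m e mu1, m e mu2).
  apply: Some_inj; rewrite -A'.
  have -> : doubled 0%R (opp_word u) = opp_word (doubled 0%R u).
    by rewrite opp_doubled oppr0.
  apply: (mullineux_asymptotic He (Hm _ He)) => //; first by rewrite S.
  rewrite eqz_mod_dvd.
  have -> : (((2 * k).+1 * e)%N%:Z - - ((2 * k).+1 * e)%N%:Z
    = (2 * (2 * k).+1)%N%:Z * e%:Z)%R by lia.
  by rewrite dvdz_mull.
by split; [exact: E1 | exact: E2 | rewrite -E2 -E1 E3].
Qed.
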